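(* Let $r\ge 2$, let $\chi^2_{m_1},\dots,\chi^2_{m_r},V$ be independent random variables, where $\chi^2_{m_i}$ is chi-square with $m_i$ degrees of freedom and $V$ is chi-square with $\nu$ degrees of freedom ($m_1,\dots,m_r,\nu$ positive integers), let $\alpha_1>\alpha_2>\cdots>\alpha_r>0$, put $|m|=m_1+\cdots+m_r$, and let $$W=\frac{(\alpha_1\chi^2_{m_1}+\cdots+\alpha_r\chi^2_{m_r})/|m|}{V/\nu}.$$ Put $a=\nu\alpha_r/|m|$, $t(y)=y/(a+y)$ and $u_i=1-\alpha_r/\alpha_i$ for $1\le i\le r$. Then the cumulative distribution function $H_W(y)=P[W\le y]$ is given, for $y>0$, by $$H_W(y)=AB_0\,\frac{y^{|m|/2}}{(|m|/2)(a+y)^{(\nu+|m|)/2}}\;F_D^{(r)}\left(\frac{\nu+|m|}{2};\frac{m_1}{2},\dots,\frac{m_{r-1}}{2},1;\frac{|m|}{2}+1;\,t(y)u_1,\dots,t(y)u_{r-1},t(y)\right).$$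
   Context: Here $$A=\prod_{i=1}^r\left(\frac{\alpha_i}{\alpha_r}\right)^{-m_i/2},\qquad B_0=a^{\nu/2}\,\frac{\Gamma\left(\frac{\nu+|m|}{2}\right)}{\Gamma\left(\frac{|m|}{2}\right)\Gamma\left(\frac{\nu}{2}\right)}.$$ $F_D^{(n)}$ denotes the Lauricella function of $n$ variables, $$F_D^{(n)}(p;b_1,\dots,b_n;s;x_1,\dots,x_n)=\sum_{i_1,\dots,i_n\ge0}\frac{(p)_{i_1+\cdots+i_n}}{(s)_{i_1+\cdots+i_n}}\prod_{k=1}^n\frac{(b_k)_{i_k}}{i_k!}x_k^{i_k},\qquad \max_k|x_k|<1,$$ where $(b)_j=b(b+1)\cdots(b+j-1)$, $(b)_0=1$, is the Pochhammer symbol. *)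

(* Defs.v *)
From HB Require Import structures.
From mathcomp Require Import all_boot all_order all_algebra.
From mathcomp Require Import all_classical all_reals all_analysis.

Set Implicit Arguments.
Unset Strict Implicit.
Unset Printing Implicit Defensive.

Import Order.TTheory GRing.Theory Num.Theory.
Import numFieldNormedType.Exports.

Local Open Scope classical_set_scope.
Local Open Scope ring_scope.

(* Euler's integral; meaningful for 0 < s. *)
Definition Gamma (R : realType) (s : R) : R :=
  (\int[lebesgue_measure]_(t in `]0%R, +oo[) (t `^ (s - 1) * expR (- t)))%R.

Definition chi2_pdf (R : realType) (k : nat) (x : R) : R :=
  if 0 < x then
    x `^ (k%:R / 2 - 1) * expR (- x / 2) / (2 `^ (k%:R / 2) * Gamma (k%:R / 2))
  else 0.

Definition chi2_prob (R : realType) (k : nat) (A : set R) : \bar R :=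
  (\int[lebesgue_measure]_(x in A) (chi2_pdf k x)%:E)%E.

Definition chi2_distributed (d : measure_display) (T : measurableType d)
    (R : realType) (P : probability T R) (X : {RV P >-> R}) (k : nat) : Prop :=
  forall A : set R, measurable A -> distribution P X A = chi2_prob k A.

(* Mutual (not merely pairwise) independence. *)
Definition mutually_independent (d : measure_display) (T : measurableType d)
    (R : realType) (P : probability T R) (I : finType)
    (X : I -> {RV P >-> R}) : Prop :=
  forall (J : {set I}) (A : I -> set R), (forall i, measurable (A i)) ->
    P (\bigcap_(i in [set` J]) (X i @^-1` A i)) =
    (\prod_(i in J) P (X i @^-1` A i))%E.

Definition pochhammer (R : realType) (b : R) (j : nat) : R :=
  \prod_(k < j) (b + k%:R).

Definition lauricellaFD_term (R : realType) (n : nat) (p : R) (b : 'I_n -> R)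
    (s : R) (x : 'I_n -> R) (i : {ffun 'I_n -> nat}) : R :=
  pochhammer p (\sum_k i k)%N / pochhammer s (\sum_k i k)%N *
  \prod_k (pochhammer (b k) (i k) / ((i k)`!)%:R * x k ^+ i k).

(* Unordered sum over all multi-indices, as the difference of the sums of the
   positive and negative parts; it is the sum of the series whenever the series
   converges absolutely, in particular when all `|x k| < 1 (and s is not a
   nonpositive integer). *)
Definition lauricellaFD (R : realType) (n : nat) (p : R) (b : 'I_n -> R)
    (s : R) (x : 'I_n -> R) : R :=
  let F := fun i => (lauricellaFD_term p b s x i)%:E in
  fine (\esum_(i in [set: {ffun 'I_n -> nat}]) (F^\+ i)%E -
        \esum_(i in [set: {ffun 'I_n -> nat}]) (F^\- i)%E)%E.

(* Main.v *)
Require Import Defs.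
From HB Require Import structures.
From mathcomp Require Import all_boot all_order all_algebra.
From mathcomp Require Import all_classical all_reals all_analysis.
From mathcomp Require Import measurable_realfun ring.

(** Write [b_i = m_i / 2], [b = |m| / 2], [q = nu / 2], and let gamma(s) be the
    gamma law of shape [s] and scale [1], of density [gamma_pdf s].

    Put [Q = sum_i alpha_i X_i / (2 alpha_r)] and [V' = V / 2]. Off the null event
    [V <= 0], the inequality [W <= y] reads [Q <= (y / a) V']. As
    [alpha_i >= alpha_r], the density of the [i]-th summand of [Q] is a power of
    [x] times [e ^ (- x) e ^ (u_i x)], and expanding [e ^ (u_i x)] exhibits it as
    [(alpha_i / alpha_r) ^ (- b_i)] times the mixture of the gamma(b_i + j) with
    weights [(b_i)_j u_i ^ j / j!] ([gamma_mixture_negbin],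
    [density_chi2_scaled]).
    Convolution adds the shapes of gamma densities ([convolution_gamma_pdf]),
    hence acts on mixtures by the Cauchy product of the weights
    ([convolution_gamma_mixture]). By independence, [Q] has density [A] times the
    mixture of the gamma(b + j) whose weights are the Cauchy product over [i]
    ([density_wsum]).

    The last argument of the Lauricella function comes from passing to the
    distribution function of [Q]: the indicator of the positive half-line is the
    sum of the densities of all gamma(1 + j), a mixture with weights
    [(1)_j 1 ^ j / j!] ([gamma_mixture1]), and convolving with it multiplies the
    weights once more. Since [u_r = 0], the [r]-th chi-square contributes only the
    unit of the Cauchy product, and the new sequence takes its place. Integrating
    each term against the density of [V'] yields Gamma values
    ([integral_gamma_pdf_dilated]) which amount to a constant times
    [(p)_j / (s)_j * t ^ j], where [p = (nu + |m|) / 2] and [s = |m| / 2 + 1]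
    ([ratio_cdf_coefE]). Finally, a series weighted by a Cauchy product of [r]
    sequences is a sum over multi-indices ([nneseries_big_cauchy]), and this one
    is the Lauricella series.

    All terms are nonnegative, so that every exchange of sums and integrals is an
    instance of Tonelli in the extended reals, and the finiteness of the final
    series follows from that of a probability. *)

Set Implicit Arguments.
Unset Strict Implicit.
Unset Printing Implicit Defensive.

Import Order.TTheory GRing.Theory Num.Theory.
Import numFieldNormedType.Exports.

Local Open Scope classical_set_scope.
Local Open Scope ring_scope.

(** * Affine changes of variable in Lebesgue integrals *)

Section affine_change_of_variables.
Context {R : realType}.
Local Notation mu := (@lebesgue_measure R).
Implicit Types (f : R -> \bar R) (c : R).
Local Open Scope ereal_scope.

(** Lebesgue measure is determined by its values on the half-open intervals,
    and the preimage of such an interval is one of the same length. *)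
Let lebesgue_measureD c (A : set R) : measurable A ->
  pushforward mu (fun x : R => (x + c)%R : measurableTypeR R) A = mu A.
Proof.
move=> mA; have mphi : measurable_fun [set: R] (fun x : R => (x + c)%R).
  exact: measurable_funD.
apply/esym/lebesgue_measure_unique => //= _ [[a b]] _ <-.
rewrite /pushforward.
have -> : (fun x : R => (x + c)%R) @^-1` `]a, b] =
    `](a - c)%R, (b - c)%R]%classic.
  by apply/seteqP; split => x; rewrite /= !in_itv/= ltrBlDr lerBrDr.
rewrite !lebesgue_measure_itv/= !lte_fin ltrD2r.
by case: ifP => // _; rewrite -!EFinD; congr EFin; ring.
Qed.

Let lebesgue_measureM c (A : set R) : (0 < c)%R -> measurable A ->
  c%:E * pushforward mu (fun x : R => (c * x)%R : measurableTypeR R) A = mu A.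
Proof.
move=> c0 mA.
have mphi : measurable_fun [set: R] (fun x : R => (c * x)%R).
  exact: measurable_funM.
pose phi (x : R) := (c * x)%R : measurableTypeR R.
have [nu nuE] : exists nu : {measure set (measurableTypeR R) -> \bar R},
    nu = pushforward mu phi :> (set _ -> \bar R).
  by unshelve eexists (pushforward mu phi).
transitivity (mscale (NngNum (ltW c0)) nu A); first by rewrite /mscale/= nuE.
apply/esym/lebesgue_measure_unique => //= _ [[a b]] _ <-.
rewrite /mscale/= nuE /pushforward.
have -> : phi @^-1` `]a, b] =
    `](a / c)%R, (b / c)%R]%classic.
  apply/seteqP; split => x; rewrite /= !in_itv/=;
  by rewrite ltr_pdivrMr// ler_pdivlMr// ![(x * _)%R]mulrC.
rewrite !lebesgue_measure_itv/= !lte_fin ltr_pM2r ?invr_gt0//.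
case: ifPn => _; last by rewrite mule0.
by rewrite -!EFinD -EFinM -mulrBl mulrC divfK// gt_eqF.
Qed.

Lemma ge0_integral_translation f c : measurable_fun [set: R] f ->
  (forall x, 0 <= f x) -> \int[mu]_x f (x + c)%R = \int[mu]_x f x.
Proof.
move=> mf f0; have mphi : measurable_fun [set: R] (fun x : R => (x + c)%R).
  exact: measurable_funD.
rewrite -[LHS](@ge0_integral_pushforward _ _ (measurableTypeR R)
  (measurableTypeR R) R (fun x : R => (x + c)%R) mphi mu setT f)//.
by apply: eq_measure_integral => A mA _; exact: lebesgue_measureD.
Qed.

Lemma ge0_integral_dilation f c : (0 < c)%R -> measurable_fun [set: R] f ->
  (forall x, 0 <= f x) -> c%:E * \int[mu]_x f (c * x)%R = \int[mu]_x f x.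
Proof.
move=> c0 mf f0; have mphi : measurable_fun [set: R] (fun x : R => (c * x)%R).
  exact: measurable_funM.
rewrite -[X in _ * X](@ge0_integral_pushforward _ _ (measurableTypeR R)
  (measurableTypeR R) R (fun x : R => (c * x)%R) mphi mu setT f)//.
rewrite -[LHS](ge0_integral_mscale _ _ (NngNum (ltW c0)))//.
by apply: eq_measure_integral => A mA _; exact: lebesgue_measureM.
Qed.

End affine_change_of_variables.

(** * Powers supported on the positive half-line *)

Section positive_powers.
Context {R : realType}.
Local Notation mu := (@lebesgue_measure R).
Implicit Types s t x z : R.

Lemma gt0_powRD x s t : 0 < x -> x `^ (s + t) = x `^ s * x `^ t.
Proof. by move=> x0; rewrite powRD// (gt_eqF x0) implybT. Qed.

(** The shape parameter is [s], so that the exponent is [s - 1]: with this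
    convention convolution adds the parameters. Cutting at [0] lets every
    integral range over the whole line. *)
Definition pos_pow s x : R := if 0 < x then x `^ (s - 1) else 0.

Lemma pos_pow_ge0 s x : 0 <= pos_pow s x.
Proof. by rewrite /pos_pow; case: ifP => // _; exact: powR_ge0. Qed.

Lemma measurable_pos_pow s : measurable_fun [set: R] (pos_pow s).
Proof.
by apply: measurable_fun_ifT; [exact: measurable_fun_ltr|exact: measurable_powR|].
Qed.

Lemma pos_powD s t x : pos_pow s x * pos_pow (t + 1) x = pos_pow (s + t) x.
Proof.
rewrite /pos_pow; case: ltrP => [x0|_]; last by rewrite mul0r.
by rewrite -gt0_powRD//; congr powR; ring.
Qed.

(** This is the Euler beta integral at [(s, 1)]. For [s < 1] the integrand is
    unbounded at [0], so the fundamental theorem is applied on [1/(n+2), 1]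
    before letting [n] grow. *)
Lemma integral_pos_pow01 s : 0 < s ->
  (\int[mu]_x (pos_pow s x * pos_pow 1 (1 - x))%:E = s^-1%:E)%E.
Proof.
move=> s0.
pose f x : \bar R := (x `^ (s - 1))%:E.
have mf (D : set R) : measurable_fun D f.
  by apply: measurable_funTS; apply/measurable_EFinP; exact: measurable_powR.
pose F n := `[@harmonic R n.+1, 1]%classic.
have ndF : nondecreasing_seq F.
  move=> n k nk; rewrite /F subsetEset; apply: subset_itvr.
  by rewrite bnd_simp /harmonic lef_pV2 ?posrE// ler_nat.
have cupF : \bigcup_i F i = `]0, 1]%classic.
  apply/seteqP; split=> x /=.
    move=> [n _]; rewrite /F/= !in_itv/= => /andP[hx ->]; rewrite andbT.
    exact: lt_le_trans hx.
  rewrite in_itv/= => /andP[x0 x1].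
  have [n nx] : exists n, n.+2%:R^-1 <= x.
    exists (Num.truncn x^-1).
    rewrite invf_ple ?posrE//; apply: ltW.
    apply: (lt_le_trans (truncnS_gt _)).
    by rewrite ler_nat.
  by exists n => //; rewrite /F/= in_itv/= nx.
transitivity (\int[mu]_(x in `]0%R, 1%R]) f x)%E.
  rewrite -integral_itv_bndo_bndc//= [RHS]integral_mkcond.
  apply: eq_integral => x _; rewrite patchE /pos_pow subr_gt0 mem_setE in_itv/=.
  case: ltP => x1; case: ltP => x0 /=; rewrite ?(mul0r, mulr0)//.
  by rewrite subrr powRr0 mulr1.
have FE n : (\int[mu]_(x in F n) f x = (s^-1 - harmonic n.+1 `^ s / s)%:E)%E.
  have h0 : 0 < @harmonic R n.+1 by exact: harmonic_gt0.
  have dF (y : R) : 0 < y -> is_derive y 1 (fun x => x `^ s / s) (y `^ (s - 1)).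
    move=> y0.
    have := @is_deriveM _ _ _ _ y 1 _ _ (is_derive1_powR s y0)
      (is_derive_cst s^-1 y 1).
    congr is_derive.
    by rewrite scaler0 add0r /GRing.scale/= mulrA mulVf ?mul1r// gt_eqF.
  have cF (y : R) : 0 < y -> {for y, continuous (fun x : R => x `^ s / s)}.
    move=> y0; apply: differentiable_continuous; apply/derivable1_diffP.
    by have [] := dF _ y0.
  rewrite (@continuous_FTC2 _ _ (fun x => x `^ s / s))//.
  - by rewrite -EFinD powR1 mul1r.
  - by rewrite /harmonic invf_lt1// ltr1n.
  - apply: continuous_in_subspaceT => y; rewrite inE/= in_itv/= => /andP[hx _].
    apply: differentiable_continuous; apply/derivable1_diffP.
    by apply: derivable_powR; rewrite in_itv/= andbT (lt_le_trans h0).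
  - split.
    + by move=> y; rewrite in_itv/= => /andP[hx _]; have [] := dF _ (lt_trans h0 hx).
    + by apply: cvg_at_right_filter; exact: cF.
    + by apply: cvg_at_left_filter; exact: cF.
  - move=> y; rewrite in_itv/= => /andP[hx _].
    by have dFx := dF _ (lt_trans h0 hx); rewrite derive1E derive_val.
have lim1 : (\int[mu]_(x in F n) f x @[n --> \oo] -->
    \int[mu]_(x in `]0%R, 1%R]) f x)%E.
  rewrite -cupF; apply: ge0_nondecreasing_set_cvg_integral => //.
  - by move=> n; exact: measurable_itv.
  - by move=> n; exact: mf.
  - by move=> n y _; rewrite lee_fin powR_ge0.
have lim2 : (\int[mu]_(x in F n) f x @[n --> \oo] --> s^-1%:E)%E.
  under eq_fun do rewrite FE.
  apply: cvg_EFin; first exact: nearW.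
  rewrite -[X in _ --> X]subr0; apply: cvgB; first exact: cvg_cst.
  rewrite -[X in _ --> X](mul0r s^-1); apply: cvgMl.
  have /cvg_at_rightP := powR_cvg0 s0; apply; split.
    by move=> n; exact: harmonic_gt0.
  have := @cvg_harmonic R; rewrite -cvg_shiftS; exact.
exact: cvg_unique lim1 lim2.
Qed.

End positive_powers.

(** * Convolution of nonnegative functions *)

Section convolution_product.
Context {R : realType}.
Local Notation mu := (@lebesgue_measure R).
Implicit Types f g phi : R -> \bar R.
Local Open Scope ereal_scope.

Definition convolution f g (z : R) : \bar R := \int[mu]_x (f x * g (z - x)%R).

Let measurable_conv_kernel f g : measurable_fun [set: R] f ->
  measurable_fun [set: R] g ->
  measurable_fun [set: R * R] (fun p => f p.1 * g (p.2 - p.1)%R).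
Proof.
move=> mf mg; apply: emeasurable_funM.
  exact: (measurableT_comp mf measurable_fst).
apply: (measurableT_comp mg).
by apply: measurable_funB; [exact: measurable_snd|exact: measurable_fst].
Qed.

Let measurable_subl (z : R) : measurable_fun [set: R] (fun x : R => (z - x)%R).
Proof. by apply: measurable_funB; [exact: measurable_cst|exact: measurable_id]. Qed.

Let measurable_subr (z : R) : measurable_fun [set: R] (fun x : R => (x - z)%R).
Proof. by apply: measurable_funB; [exact: measurable_id|exact: measurable_cst]. Qed.

(** Tonelli followed by the translation [y = z - x]. With [phi = 1] it makes
    total mass multiplicative; with [phi] an indicator it says that the
    convolution is the density of a sum. *)
Lemma integral_convolution f g phi : measurable_fun [set: R] f ->
  measurable_fun [set: R] g -> measurable_fun [set: R] phi ->
  (forall x, 0 <= f x) -> (forall x, 0 <= g x) -> (forall x, 0 <= phi x) ->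
  \int[mu]_z (convolution f g z * phi z) =
  \int[mu]_x (f x * \int[mu]_y (g y * phi (x + y)%R)).
Proof.
move=> mf mg mphi f0 g0 phi0.
transitivity (\int[mu]_z \int[mu]_x (f x * g (z - x)%R * phi z)).
  apply: eq_integral => z _; rewrite -ge0_integralZr//.
  - by apply: emeasurable_funM => //; exact: (measurableT_comp mg (measurable_subl z)).
  - by move=> x _; rewrite mule_ge0.
rewrite -(fubini_tonelli (fun p : measurableTypeR R * measurableTypeR R =>
    f p.1 * g (p.2 - p.1)%R * phi p.2)) /=; last 2 first.
- apply: emeasurable_funM; first exact: measurable_conv_kernel.
  exact: (measurableT_comp mphi measurable_snd).
- by move=> p; rewrite !mule_ge0.
apply: eq_integral => x _.
have mshift : measurable_fun [set: R] (fun y => phi (x + y)%R).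
  by apply: (measurableT_comp mphi); apply: measurable_funD.
rewrite -(@ge0_integral_translation _ (fun y => g y * phi (x + y)%R) (- x)); last 2 first.
- exact: emeasurable_funM.
- by move=> y; rewrite mule_ge0.
rewrite -ge0_integralZl//; last 2 first.
- by apply: emeasurable_funM; [exact: (measurableT_comp mg (measurable_subr x))|
    exact: (measurableT_comp mshift (measurable_subr x))].
- by move=> y _; rewrite mule_ge0.
by apply: eq_integral => z _; rewrite [(x + _)%R]addrC subrK muleA.
Qed.

End convolution_product.

(** * The Gamma function and the gamma densities *)

Section gamma_function.
Context {R : realType}.
Local Notation mu := (@lebesgue_measure R).
Implicit Types s t x z : R.

(** The Gamma and beta integrals are first handled as extended reals; their
    finiteness is a consequence of the identities between them. *)
Let gker s x : \bar R := (pos_pow s x * expR (- x))%:E.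
Let egamma s := (\int[mu]_x gker s x)%E.
Let ebeta s t := (\int[mu]_x (pos_pow s x * pos_pow t (1 - x))%:E)%E.

Lemma measurable_expRN : measurable_fun [set: R] (fun x : R => expR (- x)).
Proof. exact: (measurableT_comp (@measurable_expR R)). Qed.

Let mgker s : measurable_fun [set: R] (gker s).
Proof.
apply/measurable_EFinP; apply: measurable_funM; first exact: measurable_pos_pow.
exact: measurable_expRN.
Qed.

Let gker_ge0 s x : (0 <= gker s x)%E.
Proof. by rewrite lee_fin mulr_ge0 ?pos_pow_ge0 ?expR_ge0. Qed.

Let mbeta s t z : measurable_fun [set: R]
  (fun x : R => (pos_pow s x * pos_pow t (z - x))%:E).
Proof.
apply/measurable_EFinP; apply: measurable_funM; first exact: measurable_pos_pow.
apply: (measurableT_comp (measurable_pos_pow t)).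
by apply: measurable_funB; [exact: measurable_cst|exact: measurable_id].
Qed.

Lemma pos_powM s x z : 0 < z -> pos_pow s (z * x) = z `^ (s - 1) * pos_pow s x.
Proof.
move=> z0; rewrite /pos_pow pmulr_rgt0//; case: ltrP => x0; last by rewrite mulr0.
by rewrite powRM// ltW.
Qed.

(** The substitution [x = z w] extracts a power of [z], so the convolution of
    two powers is again a power, with the beta integral as its constant. *)
Let beta_scaling s t z : (\int[mu]_x (pos_pow s x * pos_pow t (z - x))%:E =
  (pos_pow (s + t) z)%:E * ebeta s t)%E.
Proof.
have [z0|z0] := leP z 0.
  have -> : pos_pow (s + t) z = 0 by rewrite /pos_pow ltNge z0.
  rewrite mul0e; apply: integral0_eq => x _.
  rewrite /pos_pow subr_gt0; case: (ltP 0 x) => x0; last by rewrite mul0r.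
  by rewrite ltNge (le_trans z0 (ltW x0)) mulr0.
rewrite -(ge0_integral_dilation z0 (mbeta s t z)); last first.
  by move=> x; rewrite lee_fin mulr_ge0 ?pos_pow_ge0.
have -> : pos_pow (s + t) z = z * (z `^ (s - 1) * z `^ (t - 1)).
  rewrite /pos_pow z0 (_ : s + t - 1 = 1 + ((s - 1) + (t - 1))); last by ring.
  by rewrite !gt0_powRD// powRr1 ?ltW.
rewrite EFinM -muleA; congr (_ * _)%E.
rewrite -ge0_integralZl//; last 3 first.
- exact: mbeta.
- by move=> x _; rewrite lee_fin mulr_ge0 ?pos_pow_ge0.
- by rewrite lee_fin mulr_ge0 ?powR_ge0.
apply: eq_integral => x _; rewrite -EFinM (_ : z - z * x = z * (1 - x)); last by ring.
rewrite !pos_powM//.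
by congr EFin; ring.
Qed.

Let convolution_gker s t z : convolution (gker s) (gker t) z =
  (gker (s + t) z * ebeta s t)%E.
Proof.
rewrite /gker [in RHS]mulrC EFinM -muleA -beta_scaling -ge0_integralZl//; last 2 first.
- exact: mbeta.
- by move=> x _; rewrite lee_fin mulr_ge0 ?pos_pow_ge0.
apply: eq_integral => x _; rewrite -!EFinM; congr EFin.
rewrite (_ : - z = - x + - (z - x)); last by ring.
by rewrite expRD; ring.
Qed.

(** The convolution of the two Gamma integrands is computed by
    [convolution_gker]; this compares total masses. The functional equation of
    Gamma is the case [t = 1]. *)
Let egammaM s t : (egamma s * egamma t = egamma (s + t) * ebeta s t)%E.
Proof.
have eg0 r : (0 <= egamma r)%E by exact: integral_ge0.
have eb0 : (0 <= ebeta s t)%E.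
  by apply: integral_ge0 => x _; rewrite lee_fin mulr_ge0 ?pos_pow_ge0.
transitivity (\int[mu]_z (convolution (gker s) (gker t) z * 1))%E.
  rewrite (integral_convolution (mgker s) (mgker t) (measurable_cst 1%E))//.
  transitivity (\int[mu]_x (gker s x * egamma t))%E.
    by rewrite ge0_integralZr//; exact: mgker.
  by apply: eq_integral => x _; under [in RHS]eq_integral do rewrite mule1.
transitivity (\int[mu]_z (gker (s + t) z * ebeta s t))%E.
  by apply: eq_integral => x _; rewrite mule1 convolution_gker.
by rewrite ge0_integralZr//; exact: mgker.
Qed.

Let egamma_ge0 s : (0 <= egamma s)%E.
Proof. exact: integral_ge0. Qed.

Let ebeta_s1 s : 0 < s -> ebeta s 1 = s^-1%:E.
Proof. exact: integral_pos_pow01. Qed.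

Let egammaE s : egamma s =
  (\int[mu]_(x in `]0%R, +oo[) (x `^ (s - 1) * expR (- x))%:E)%E.
Proof.
rewrite [RHS]integral_mkcond; apply: eq_integral => x _.
rewrite /gker /pos_pow patchE mem_setE in_itv/= andbT.
by case: ifP => // _; rewrite mul0r.
Qed.

Let egamma1 : egamma 1 = 1%E.
Proof.
rewrite egammaE -(@integral_exponential_pdf R 1)//.
under eq_integral do rewrite subrr powRr0 mul1r.
rewrite integral_itv_obnd_cbnd; last first.
  by apply/measurable_EFinP; apply: measurable_funTS; exact: measurable_expRN.
rewrite integral_mkcond; apply: eq_integral => x _.
rewrite /exponential_pdf !patchE; case: ifP => // _.
by rewrite mul1r mulN1r.
Qed.

Let egammaD1 s : 0 < s -> (egamma (s + 1) = s%:E * egamma s)%E.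
Proof.
move=> s0; have := egammaM s 1.
rewrite egamma1 mule1 (ebeta_s1 s0) => ->.
by rewrite muleCA -EFinM divff ?mule1// gt_eqF.
Qed.

Let egamma_gt0 s : (0 < egamma s)%E.
Proof.
rewrite lt_neqAle egamma_ge0 andbT eq_sym; apply/eqP => eg0.
have : (\int[mu]_x `|gker s x| = 0)%E.
  by rewrite -[RHS]eg0; apply: eq_integral => x _; rewrite gee0_abs.
move=> /(ae_eq_integral_abs mu measurableT (mgker s)) ae0.
have neg : mu.-negligible `]0%R, 1%R].
  apply: negligibleS ae0 => x /=; rewrite in_itv/= => /andP[x0 _] /(_ I)/eqP.
  by rewrite /gker /pos_pow x0 eqe mulf_eq0 !gt_eqF ?expR_gt0 ?powR_gt0.
have : mu `]0%R, 1%R]%classic = 0%E.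
  by apply: measure_negligible => //; exact: measurable_itv.
rewrite lebesgue_measure_itv/= lte_fin ltr01 oppr0 adde0.
by move=> /eqP; rewrite onee_eq0.
Qed.

(** Below [x = 1] the integrand is dominated by that of the beta integral at
    [(s, 1)], above it by [e^-x]. Larger [s] are reached by [egammaD1]. *)
Let egamma_le1 s : 0 < s <= 1 -> (egamma s < +oo)%E.
Proof.
move=> /andP[s0 s1].
apply: (@le_lt_trans _ _ (ebeta s 1 + egamma 1)%E); last first.
  by rewrite ebeta_s1// egamma1 -EFinD ltry.
have b0 x : (0 <= (pos_pow s x * pos_pow 1 (1 - x))%:E :> \bar R)%E.
  by rewrite lee_fin mulr_ge0 ?pos_pow_ge0.
have -> : (ebeta s 1 + egamma 1 =
    \int[mu]_x ((pos_pow s x * pos_pow 1 (1 - x))%:E + gker 1 x))%E.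
  by rewrite ge0_integralD//; [exact: mbeta|exact: mgker].
apply: ge0_le_integral => //; [exact: mgker| |].
  by apply: emeasurable_funD; [exact: mbeta|exact: mgker].
move=> x _; rewrite -EFinD lee_fin /pos_pow subr_gt0.
case: ltP => x0; last by rewrite !mul0r addr0.
rewrite subrr !powRr0 mul1r; case: ltP => x1.
  rewrite mulr1 ler_wpDr ?expR_ge0// ler_piMr ?powR_ge0//.
  by rewrite expR_le1 oppr_le0 ltW.
rewrite mulr0 add0r ler_piMl ?expR_ge0//.
by rewrite -[leRHS](powRr0 x) ler_powR// subr_le0.
Qed.

Let egamma_lty s : 0 < s -> (egamma s < +oo)%E.
Proof.
move=> s0; have [n] : exists n : nat, s <= n.+1%:R.
  by exists (Num.truncn s); apply/ltW/truncnS_gt.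
elim: n s s0 => [|n IH] s s0 sn; first by apply: egamma_le1; rewrite s0.
have [s1|s1] := leP s 1; first by apply: egamma_le1; rewrite s0.
rewrite -(subrK 1 s) egammaD1 ?subr_gt0// lte_mul_pinfty//.
- by rewrite lee_fin subr_ge0 ltW.
- by apply: IH; rewrite ?subr_gt0// lerBlDr natr1.
Qed.

Lemma EFin_Gamma s : 0 < s ->
  (Gamma s)%:E = (\int[mu]_x (pos_pow s x * expR (- x))%:E)%E.
Proof.
move=> s0; have := egamma_lty s0; rewrite -ge0_fin_numE// /Gamma /Rintegral -egammaE.
by move=> /fineK.
Qed.

Lemma Gamma_gt0 s : 0 < s -> 0 < Gamma s.
Proof. by move=> s0; rewrite -lte_fin EFin_Gamma// egamma_gt0. Qed.

Lemma GammaD1 s : 0 < s -> Gamma (s + 1) = s * Gamma s.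
Proof.
move=> s0; apply: EFin_inj; rewrite EFin_Gamma ?addr_gt0// EFinM EFin_Gamma//.
exact: egammaD1.
Qed.

Lemma Gamma1 : Gamma (1 : R) = 1.
Proof. by apply: EFin_inj; rewrite EFin_Gamma// -egamma1. Qed.

Definition gamma_pdf s x : R := pos_pow s x * expR (- x) / Gamma s.

Lemma gamma_pdf_ge0 s x : 0 < s -> 0 <= gamma_pdf s x.
Proof.
move=> s0; rewrite /gamma_pdf divr_ge0 ?mulr_ge0 ?pos_pow_ge0 ?expR_ge0//.
by rewrite ltW// Gamma_gt0.
Qed.

Lemma measurable_gamma_pdf s : measurable_fun [set: R] (gamma_pdf s).
Proof.
apply: measurable_funM; last exact: measurable_cst.
by apply: measurable_funM; [exact: measurable_pos_pow|exact: measurable_expRN].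
Qed.

(** The reproductive property: shapes add when independent gamma variables of
    the same scale are added. *)
Lemma convolution_gamma_pdf s t z : 0 < s -> 0 < t ->
  convolution (EFin \o gamma_pdf s) (EFin \o gamma_pdf t) z =
  (gamma_pdf (s + t) z)%:E.
Proof.
move=> s0 t0.
have st0 : 0 < s + t by rewrite addr_gt0.
have Gs := Gamma_gt0 s0; have Gt := Gamma_gt0 t0; have Gst := Gamma_gt0 st0.
have B : ebeta s t = (Gamma s * Gamma t / Gamma (s + t))%:E.
  have eG r : 0 < r -> egamma r = (Gamma r)%:E by move=> r0; rewrite EFin_Gamma.
  have := egammaM s t; rewrite !eG//.
  move=> /(congr1 (fun e : \bar R => e * (Gamma (s + t))^-1%:E)%E) e.
  by rewrite 2!EFinM e [RHS]muleAC -EFinM divff ?mul1e// gt_eqF.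
have -> : convolution (EFin \o gamma_pdf s) (EFin \o gamma_pdf t) z =
    (((Gamma s * Gamma t)^-1)%:E * convolution (gker s) (gker t) z)%E.
  rewrite /convolution -ge0_integralZl//; last 3 first.
  - apply: emeasurable_funM; first exact: mgker.
    apply: (measurableT_comp (mgker t)).
    by apply: measurable_funB; [exact: measurable_cst|exact: measurable_id].
  - by move=> x _; rewrite mule_ge0.
  - by rewrite lee_fin invr_ge0 (ltW (mulr_gt0 Gs Gt)).
  - apply: eq_integral => x _; rewrite /= -!EFinM; congr EFin.
    rewrite /gamma_pdf invfM.
    by move: (Gamma s) (Gamma t) => a b; ring.
rewrite convolution_gker B -!EFinM; congr EFin; rewrite /gamma_pdf.
move: (Gamma s) (Gamma t) (Gamma (s + t)) Gs Gt Gst => a b c a0 b0 c0.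
by field; rewrite (gt_eqF a0) (gt_eqF b0) (gt_eqF c0).
Qed.

End gamma_function.

(* Keeps unification from unfolding Gamma into its defining integral. *)
Local Opaque Gamma.

(** * Cauchy products of sequences *)

Section cauchy_product.
Context {R : realType}.
Implicit Types (c d e : nat -> R) (G : nat -> \bar R).

Definition cauchy_prod c d (n : nat) : R := \sum_(k < n.+1) c k * d (n - k)%N.

Definition delta0 (n : nat) : R := (n == 0%N)%:R.

(** The monoid laws are inherited from polynomial multiplication: the [n]-th
    term of a Cauchy product only involves terms of index at most [n]. *)
Let trunc N c : {poly R} := \poly_(i < N) c i.

Let coef_trunc N c n : (n < N)%N -> (trunc N c)`_n = c n.
Proof. by rewrite coef_poly => ->. Qed.

Let cauchyE N c d n : (n < N)%N -> cauchy_prod c d n = (trunc N c * trunc N d)`_n.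
Proof.
move=> nN; rewrite coefM; apply: eq_bigr => k _.
have kn : (k <= n)%N by rewrite -ltnS.
by rewrite !coef_trunc// (leq_ltn_trans _ nN)// leq_subr.
Qed.

Lemma cauchyC : commutative cauchy_prod.
Proof.
by move=> c d; apply/funext => n; rewrite !(@cauchyE n.+1)// mulrC.
Qed.

Lemma cauchyA : associative cauchy_prod.
Proof.
move=> c d e; apply/funext => n.
transitivity ((trunc n.+1 c * (trunc n.+1 d * trunc n.+1 e))`_n).
  rewrite [RHS]coefM; apply: eq_bigr => k _.
  by rewrite coef_trunc// (@cauchyE n.+1)// ltnS leq_subr.
rewrite mulrA [LHS]coefM; apply: eq_bigr => k _.
by rewrite -cauchyE// coef_trunc// ltnS leq_subr.
Qed.

Lemma cauchy0d : left_id delta0 cauchy_prod.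
Proof.
move=> c; apply/funext => n; rewrite /cauchy_prod big_ord_recl /delta0 /= mul1r subn0.
by rewrite big1 ?addr0// => k _; rewrite mul0r.
Qed.

HB.instance Definition _ :=
  Monoid.isComLaw.Build (nat -> R) delta0 cauchy_prod cauchyA cauchyC cauchy0d.

Lemma cauchy_ge0 c d : (forall n, 0 <= c n) -> (forall n, 0 <= d n) ->
  forall n, 0 <= cauchy_prod c d n.
Proof. by move=> c0 d0 n; apply: sumr_ge0 => k _; rewrite mulr_ge0. Qed.

Lemma delta0_ge0 n : 0 <= delta0 n.
Proof. by rewrite ler0n. Qed.

Local Open Scope ereal_scope.

(** Both sides sum [c i * d j * G (i + j)] over all pairs, on the right grouped
    by the antidiagonals [i + j = n]. *)
Lemma nneseries_cauchy c d G : (forall n, 0 <= c n)%R -> (forall n, 0 <= d n)%R ->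
  (forall n, 0 <= G n) ->
  \sum_(i <oo) (c i)%:E * \sum_(j <oo) (d j)%:E * G (i + j)%N =
  \sum_(n <oo) (cauchy_prod c d n)%:E * G n.
Proof.
move=> c0 d0 G0.
have a0 i j : 0 <= (c i * d j)%:E * G (i + j)%N.
  by rewrite mule_ge0// lee_fin mulr_ge0.
transitivity (\esum_(i in [set: nat]) \esum_(j in [set: nat])
    (c i * d j)%:E * G (i + j)%N).
  rewrite nneseries_esumT; last first.
    move=> i; rewrite mule_ge0 ?lee_fin//; apply: nneseries_ge0 => j _ _.
    by rewrite mule_ge0 ?lee_fin.
  apply: eq_esum => i _; rewrite -nneseriesZl; last first.
    by move=> j _; rewrite mule_ge0 ?lee_fin.
  by rewrite -nneseries_esumT//; apply: eq_eseriesr => j _; rewrite EFinM muleA.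
rewrite esum_esum//.
transitivity (\esum_(n in [set: nat]) \esum_(k in `I_n.+1)
    (c k * d (n - k)%N)%:E * G n).
  rewrite esum_esum; last by move=> n k _ _; rewrite mule_ge0 ?lee_fin ?mulr_ge0.
  rewrite [RHS](reindex_esum ([set: nat] `*`` (fun=> [set: nat])) _
    (fun p => (p.1 + p.2, p.1)%N)).
    by apply: eq_esum => -[i j] _ /=; rewrite addKn.
  split => //=.
  - by move=> [i j] _ /=; rewrite ltnS leq_addr.
  - by move=> [i j] [i' j'] _ _ /= [/[swap] -> /addnI ->].
  - by move=> [n k] [_ /= kn]; exists (k, n - k)%N => //=; rewrite subnKC.
rewrite nneseries_esumT; last by move=> n; rewrite mule_ge0 ?lee_fin ?cauchy_ge0.
apply: eq_esum => n _; rewrite esum_fset//; last first.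
  by move=> k _; rewrite mule_ge0 ?lee_fin ?mulr_ge0.
rewrite -fsbig_ord -ge0_sume_distrl.
  by rewrite sumEFin.
by move=> k _; rewrite lee_fin mulr_ge0.
Qed.

End cauchy_product.

(** * Cauchy products of several sequences and multi-indices *)

Section multi_indices.
Context {R : realType}.
Local Open Scope ereal_scope.

Lemma ge0_esumZl (T : choiceType) (S : set T) (r : R) (a : T -> \bar R) :
  (0 <= r)%R -> (forall i, 0 <= a i) ->
  \esum_(i in S) r%:E * a i = r%:E * \esum_(i in S) a i.
Proof.
move=> r0 a0; rewrite /esum -ereal_supZl//.
  rewrite image_comp; congr ereal_sup; apply: eq_imagel => A _ /=.
  by rewrite ge0_mule_fsumr.
apply/set0P; exists (\sum_(i \in set0) a i); exists set0 => //.
exact: fsets_set0.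
Qed.

(** The [j]-th term of a Cauchy product of [n] sequences is a sum over the
    multi-indices of total degree [j]; this is what turns a single series into
    a Lauricella series. One index is split off at each induction step. *)
Lemma nneseries_big_cauchy n (D : 'I_n -> nat -> R) (G : nat -> \bar R) :
  (forall k j, 0 <= D k j)%R -> (forall j, 0 <= G j) ->
  \sum_(j <oo) ((\big[@cauchy_prod R/@delta0 R]_(k < n) D k) j)%:E * G j =
  \esum_(i in [set: {ffun 'I_n -> nat}])
    (\prod_k D k (i k))%:E * G (\sum_k i k)%N.
Proof.
elim: n D G => [|n IH] D G D0 G0.
  rewrite big_ord0 nneseries_esumT; last first.
    by move=> j; rewrite mule_ge0// lee_fin delta0_ge0.
  have -> : [set: {ffun 'I_0 -> nat}] = [set [ffun=> 0%N]].
    by apply/seteqP; split => // i _ /=; apply/ffunP => -[].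
  rewrite esum_set1; last by rewrite mule_ge0// lee_fin prodr_ge0.
  rewrite !big_ord0 mul1e.
  rewrite (_ : \esum_(i in [set: nat]) _ = \esum_(i in [set 0%N]) G i); last first.
    rewrite [RHS]esum_mkcond; apply: eq_esum => j _; rewrite /delta0.
    have [->|j0] := eqVneq j 0%N; first by rewrite mem_set// mul1e.
    by rewrite memNset ?mul0e//; exact/eqP.
  by rewrite esum_set1.
have C0 j : (0 <= (\big[@cauchy_prod R/@delta0 R]_(k < n) D (lift ord0 k)) j)%R.
  elim/big_ind : _ j => [j|c d c0 d0|//]; [exact: delta0_ge0|exact: cauchy_ge0].
rewrite big_ord_recl -nneseries_cauchy//.
pose e (p : nat * {ffun 'I_n -> nat}) : {ffun 'I_n.+1 -> nat} :=
  [ffun k => if unlift ord0 k is Some j then p.2 j else p.1].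
have e0 p : e p ord0 = p.1 by rewrite ffunE unlift_none.
have eS p j : e p (lift ord0 j) = p.2 j by rewrite ffunE liftK.
rewrite (reindex_esum
  ([set: nat] `*`` (fun=> [set: {ffun 'I_n -> nat}])) _ e); last first.
  split => //=.
  - move=> [i f] [i' f'] _ _ eif.
    have ii' : i = i'.
      by have := congr1 (fun g : {ffun _} => g ord0) eif; rewrite !e0.
    congr pair => //; apply/ffunP => j.
    by have := congr1 (fun g : {ffun _} => g (lift ord0 j)) eif; rewrite !eS.
  - move=> g _; exists (g ord0, [ffun j => g (lift ord0 j)]) => //.
    apply/ffunP => k; rewrite ffunE/=; case: unliftP => [j ->|->//].
    by rewrite ffunE.
rewrite -(esum_esum _ (a := fun i f =>
  (\prod_k D k (e (i, f) k))%:E * G (\sum_k e (i, f) k)%N)); last first.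
  by move=> i f _ _; rewrite mule_ge0// lee_fin prodr_ge0.
rewrite nneseries_esumT; last first.
  move=> j; rewrite mule_ge0 ?lee_fin//; apply: nneseries_ge0 => k _ _.
  by rewrite mule_ge0 ?lee_fin.
apply: eq_esum => i _; rewrite (IH _ (fun j => G (i + j)%N))//.
rewrite -ge0_esumZl//; last by move=> f; rewrite mule_ge0// lee_fin prodr_ge0.
apply: eq_esum => f _; rewrite !big_ord_recl !e0/= muleA -EFinM.
by congr (_%:E * G _); [congr (_ * _)%R|congr addn];
  apply: eq_bigr => j _; rewrite eS.
Qed.

End multi_indices.

(** * Mixtures of gamma densities *)

Section gamma_mixtures.
Context {R : realType}.
Local Notation mu := (@lebesgue_measure R).
Implicit Types (b u s t x z : R) (c d : nat -> R).

Lemma pochhammerS b n : pochhammer b n.+1 = pochhammer b n * (b + n%:R).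
Proof. by rewrite /pochhammer big_ord_recr. Qed.

Lemma pochhammer_gt0 b n : 0 < b -> 0 < pochhammer b n.
Proof. by move=> b0; apply: prodr_gt0 => k _; rewrite ltr_pwDl. Qed.

Lemma GammaDn b n : 0 < b -> Gamma (b + n%:R) = pochhammer b n * Gamma b.
Proof.
move=> b0; elim: n => [|n IH]; first by rewrite addr0 /pochhammer big_ord0 mul1r.
have bn0 : 0 < b + n%:R by rewrite ltr_pwDl.
rewrite -natr1 addrA (GammaD1 bn0) IH pochhammerS.
by move: (Gamma b) => g; ring.
Qed.

(** The coefficient of [x ^ j] in [(1 - u x) ^ (-b)]; up to normalization the
    weights of a negative binomial law. *)
Definition negbin b u (j : nat) : R := pochhammer b j / j`!%:R * u ^+ j.

Lemma negbin_ge0 b u j : 0 < b -> 0 <= u -> 0 <= negbin b u j.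
Proof.
move=> b0 u0; rewrite /negbin mulr_ge0 ?exprn_ge0// divr_ge0//.
exact/ltW/pochhammer_gt0.
Qed.

(** A chi-square term of smallest scale has [u = 0]: it contributes no index
    to the mixture, which frees one argument of the Lauricella function. *)
Lemma negbin0 b : negbin b 0 = delta0.
Proof.
apply/funext => -[|n]; rewrite /negbin /delta0 ?expr0n/= ?mulr0//.
by rewrite /pochhammer big_ord0 fact0 divr1 mulr1.
Qed.

(** Extended-real valued, so that no convergence has to be shown. *)
Definition gamma_mixture s c x : \bar R :=
  (\sum_(n <oo) (c n)%:E * (gamma_pdf (s + n%:R) x)%:E)%E.

Lemma gamma_mixture_ge0 s c x : 0 < s -> (forall n, 0 <= c n) ->
  (0 <= gamma_mixture s c x)%E.
Proof.
move=> s0 c0; apply: nneseries_ge0 => n _ _.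
by rewrite mule_ge0 ?lee_fin// gamma_pdf_ge0// ltr_pwDl.
Qed.

Lemma measurable_gamma_mixture s c : 0 < s -> (forall n, 0 <= c n) ->
  measurable_fun [set: R] (gamma_mixture s c).
Proof.
move=> s0 c0; apply: ge0_emeasurable_sum => [n x _ _|n _].
  by rewrite mule_ge0 ?lee_fin// gamma_pdf_ge0// ltr_pwDl.
apply: emeasurable_funM => //; apply/measurable_EFinP.
exact: measurable_gamma_pdf.
Qed.

Let nneseries_expR x : 0 <= x ->
  (\sum_(n <oo) (x ^+ n / n`!%:R)%:E = (expR x)%:E)%E.
Proof.
move=> x0; apply/cvg_lim => //.
have -> : (fun n => \sum_(0 <= k < n) (x ^+ k / k`!%:R)%:E)%E =
    EFin \o series (exp_coeff x).
  by apply/funext => n; rewrite sumEFin.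
by apply: cvg_EFin; [exact: nearW|exact: is_cvg_series_exp_coeff].
Qed.

(** Expand [e ^ (u x)] and absorb [x ^ n] into the shape: by the functional
    equation of Gamma, [Gamma (b + n)] and [(b)_n] cancel. *)
Lemma gamma_mixture_negbin b u x : 0 < b -> 0 <= u ->
  gamma_mixture b (negbin b u) x =
  (pos_pow b x * expR (u * x) * expR (- x) / Gamma b)%:E.
Proof.
move=> b0 u0; have Gb := Gamma_gt0 b0.
have [x0|x0] := leP x 0.
  rewrite /pos_pow ltNge x0/= !mul0r; apply: eseries0 => n _ _.
  by rewrite /gamma_pdf /pos_pow ltNge x0/= !mul0r mule0.
have ux0 : 0 <= u * x by rewrite mulr_ge0// ltW.
transitivity ((pos_pow b x * expR (- x) / Gamma b)%:E *
   \sum_(n <oo) ((u * x) ^+ n / n`!%:R)%:E)%E; last first.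
  rewrite nneseries_expR// -EFinM; congr EFin.
  by move: (Gamma b) => g; ring.
rewrite -nneseriesZl; last by move=> n _; rewrite lee_fin divr_ge0// exprn_ge0.
apply: eq_eseriesr => n _; rewrite -!EFinM; congr EFin.
rewrite /negbin /gamma_pdf GammaDn//.
have -> : pos_pow (b + n%:R) x = pos_pow b x * x ^+ n.
  by rewrite /pos_pow x0 -powR_mulrn ?ltW// -gt0_powRD//; congr powR; ring.
have := pochhammer_gt0 n b0; have : 0 < n`!%:R :> R by rewrite ltr0n fact_gt0.
rewrite exprMn; move: (Gamma b) (pochhammer b n) (n`!%:R : R) Gb => g p f g0 f0 p0.
by field; rewrite (gt_eqF g0) (gt_eqF f0) (gt_eqF p0).
Qed.

(** The densities of the arrival times of a rate one Poisson process sum to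
    [1] on the positive half-line. Convolving with this mixture therefore
    computes distribution functions, and its weights [(1)_j 1 ^ j / j!] become
    the last parameter of the Lauricella function. *)
Lemma gamma_mixture1 x :
  gamma_mixture 1 (negbin 1 1) x = (if 0 < x then 1 else 0)%:E.
Proof.
rewrite gamma_mixture_negbin// /pos_pow mul1r Gamma1 divr1 subrr powRr0.
by case: ifP => _; rewrite ?mul0r// mul1r -expRD subrr expR0.
Qed.

(** The factor may be infinite here, which is why the series is seen as an
    integral for the counting measure. *)
Let ge0_nneseriesZl (f : nat -> \bar R) (k : \bar R) :
  (0 <= k)%E -> (forall n, 0 <= f n)%E ->
  (\sum_(n <oo) k * f n = k * \sum_(n <oo) f n)%E.
Proof.
move=> k0 f0; rewrite -!ge0_integral_count//; last by move=> n; rewrite mule_ge0.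
by rewrite ge0_integralZl.
Qed.

(** By Tonelli, the convolution distributes over both series; shapes add and
    weights multiply. *)
Lemma convolution_gamma_mixture s t c d z : 0 < s -> 0 < t ->
  (forall n, 0 <= c n) -> (forall n, 0 <= d n) ->
  convolution (gamma_mixture s c) (gamma_mixture t d) z =
  gamma_mixture (s + t) (cauchy_prod c d) z.
Proof.
move=> s0 t0 c0 d0.
have sn0 n : 0 < s + n%:R by rewrite ltr_pwDl.
have tn0 n : 0 < t + n%:R by rewrite ltr_pwDl.
have msub : measurable_fun [set: R] (fun x : R => z - x).
  by apply: measurable_funB; [exact: measurable_cst|exact: measurable_id].
have mt : measurable_fun [set: R] (fun x => gamma_mixture t d (z - x)).
  exact: (measurableT_comp (measurable_gamma_mixture t0 d0) msub).
have m1 r : measurable_fun [set: R] (EFin \o gamma_pdf r).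
  by apply/measurable_EFinP; exact: measurable_gamma_pdf.
have m2 r : measurable_fun [set: R] (fun x => (gamma_pdf r (z - x))%:E).
  exact: (measurableT_comp (m1 r) msub).
have mt0 x : (0 <= gamma_mixture t d x)%E by exact: gamma_mixture_ge0.
have g0 r x : 0 < r -> (0 <= (gamma_pdf r x)%:E)%E.
  by move=> r0; rewrite lee_fin gamma_pdf_ge0.
have stn0 n : 0 < s + t + n%:R by rewrite ltr_pwDl// addr_gt0.
have := nneseries_cauchy c0 d0 (fun n => g0 _ z (stn0 n)).
rewrite -[X in _ = X -> _]/(gamma_mixture (s + t) (cauchy_prod c d) z) => <-.
transitivity (\sum_(i <oo) \int[mu]_x
   ((c i)%:E * ((gamma_pdf (s + i%:R) x)%:E * gamma_mixture t d (z - x))))%E.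
  rewrite -integral_nneseries//; last 2 first.
  - move=> i; apply: emeasurable_funM => //; apply: emeasurable_funM => //.
    exact: m1.
  - by move=> i x _; rewrite !mule_ge0// ?lee_fin// -lee_fin g0.
  apply: eq_integral => x _.
  rewrite [LHS]muleC -ge0_nneseriesZl//; last first.
    by move=> i; rewrite mule_ge0 ?lee_fin// -lee_fin g0.
  by apply: eq_eseriesr => i _; rewrite muleC muleA.
apply: eq_eseriesr => i _.
rewrite ge0_integralZl//; last 3 first.
- by apply: emeasurable_funM => //; exact: m1.
- by move=> x _; rewrite mule_ge0// g0.
- by rewrite lee_fin.
congr (_ * _)%E.
transitivity (\sum_(j <oo) \int[mu]_x
   ((d j)%:E * ((gamma_pdf (s + i%:R) x)%:E * (gamma_pdf (t + j%:R) (z - x))%:E)))%E.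
  rewrite -integral_nneseries//; last 2 first.
  - move=> j; apply: emeasurable_funM => //; apply: emeasurable_funM => //.
      exact: m1.
    exact: m2.
  - by move=> j x _; rewrite !mule_ge0// ?lee_fin// -lee_fin g0.
  apply: eq_integral => x _; rewrite /gamma_mixture -nneseriesZl; last first.
    by move=> j _; rewrite mule_ge0 ?lee_fin// -lee_fin g0.
  by apply: eq_eseriesr => j _; rewrite muleCA.
apply: eq_eseriesr => j _.
rewrite ge0_integralZl//; last 3 first.
- by apply: emeasurable_funM; [exact: m1|exact: m2].
- by move=> x _; rewrite mule_ge0// g0.
- by rewrite lee_fin.
congr (_ * _)%E.
rewrite -[LHS]/(convolution (EFin \o gamma_pdf _) (EFin \o gamma_pdf _) z).
rewrite (convolution_gamma_pdf _ (sn0 i) (tn0 j)) natrD.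
by congr (gamma_pdf _ _)%:E; ring.
Qed.

Lemma integral_pos_pow_expR s l : 0 < s -> 0 < l ->
  (\int[mu]_x (pos_pow s x * expR (- (l * x)))%:E = (Gamma s / l `^ s)%:E)%E.
Proof.
move=> s0 l0.
have m (k : R) :
    measurable_fun [set: R] (fun x => (pos_pow s x * expR (- (k * x)))%:E).
  apply/measurable_EFinP; apply: measurable_funM; first exact: measurable_pos_pow.
  by apply: (measurableT_comp (@measurable_expRN R)); exact: measurable_funM.
have f0 (k x : R) : (0 <= (pos_pow s x * expR (- (k * x)))%:E)%E.
  by rewrite lee_fin mulr_ge0 ?pos_pow_ge0 ?expR_ge0.
have := ge0_integral_dilation l0 (m 1) (f0 1).
under [X in _ = X -> _]eq_integral do rewrite mul1r.
rewrite -EFin_Gamma//.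
under eq_integral do rewrite mul1r pos_powM// -mulrA EFinM.
rewrite ge0_integralZl//; [|exact: m|by rewrite lee_fin powR_ge0].
rewrite muleA -EFinM mulr_powRB1 ?ltW//.
move=> /(congr1 (fun e : \bar R => (l `^ s)^-1%:E * e)%E).
by rewrite muleA -!EFinM mulVf ?gt_eqF ?powR_gt0// mul1e mulrC.
Qed.

(** The two densities multiply to a power times [e ^ (- (1 + k) v)], whose
    integral is a Gamma value. *)
Lemma integral_gamma_pdf_dilated q s k : 0 < q -> 0 < s -> 0 < k ->
  (\int[mu]_v ((gamma_pdf q v)%:E * (gamma_pdf (s + 1) (k * v))%:E) =
  (Gamma (q + s) / (Gamma q * Gamma (s + 1)) * (k `^ s / (1 + k) `^ (q + s)))%:E)%E.
Proof.
move=> q0 s0 k0.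
have qs0 : 0 < q + s by rewrite addr_gt0.
have s10 : 0 < s + 1 by rewrite addr_gt0.
have k10 : 0 < 1 + k by rewrite addr_gt0.
transitivity ((k `^ s / (Gamma q * Gamma (s + 1)))%:E *
   \int[mu]_v (pos_pow (q + s) v * expR (- ((1 + k) * v)))%:E)%E; last first.
  rewrite integral_pos_pow_expR// -EFinM; congr EFin.
  by move: (Gamma q) (Gamma _) (Gamma _) => x y z; ring.
rewrite -ge0_integralZl//; last 3 first.
- apply/measurable_EFinP; apply: measurable_funM; first exact: measurable_pos_pow.
  by apply: (measurableT_comp (@measurable_expRN R)); exact: measurable_funM.
- by move=> x _; rewrite lee_fin mulr_ge0 ?pos_pow_ge0 ?expR_ge0.
- by rewrite lee_fin divr_ge0 ?powR_ge0// ltW// mulr_gt0 ?Gamma_gt0.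
apply: eq_integral => v _; rewrite -!EFinM; congr EFin.
rewrite /gamma_pdf pos_powM// -(pos_powD q s v) addrK mulrDl mul1r opprD expRD.
by rewrite invfM; move: (Gamma q) (Gamma _) => x y; ring.
Qed.

End gamma_mixtures.

Lemma convolution_scaled_mixtures (R : realType) (s t k l z : R)
    (e f : nat -> R) :
  (0 < s)%R -> (0 < t)%R -> (0 <= k)%R -> (0 <= l)%R ->
  (forall n, 0 <= e n)%R -> (forall n, 0 <= f n)%R ->
  (convolution (fun x => k%:E * gamma_mixture s e x)
    (fun x => l%:E * gamma_mixture t f x) z =
  (k * l)%:E * gamma_mixture (s + t) (cauchy_prod e f) z)%E.
Proof.
move=> s0 t0 k0 l0 e0 f0; rewrite -(convolution_gamma_mixture _ s0 t0 e0 f0).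
have msub : measurable_fun [set: R] (fun x : R => z - x)%R.
  by apply: measurable_funB; [exact: measurable_cst|exact: measurable_id].
rewrite /convolution -ge0_integralZl//.
- by apply: eq_integral => x _; rewrite EFinM !muleA; congr (_ * _)%E; rewrite muleAC.
- apply: emeasurable_funM; first exact: measurable_gamma_mixture.
  exact: (measurableT_comp (measurable_gamma_mixture t0 f0) msub).
- by move=> x _; rewrite mule_ge0// gamma_mixture_ge0.
- by rewrite lee_fin mulr_ge0.
Qed.

(** * Joint laws and densities *)

Section measure_with_density.
Context d (T : measurableType d) (R : realType).
Variables (mu : {measure set T -> \bar R}) (f : T -> \bar R).
Hypotheses (mf : measurable_fun [set: T] f) (f0 : forall x, (0 <= f x)%E).
Local Open Scope ereal_scope.

Let with_density (D : set T) : \bar R := \int[mu]_(x in D) f x.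

Let with_density0 : with_density set0 = 0.
Proof. by rewrite /with_density integral_set0. Qed.

Let with_density_ge0 D : 0 <= with_density D.
Proof. exact: integral_ge0. Qed.

Let with_density_sigma_additive : semi_sigma_additive with_density.
Proof.
move=> F mF tF mUF; rewrite /with_density; apply: cvg_toP.
  apply: ereal_nondecreasing_is_cvgn => m n mn.
  by apply: lee_sum_nneg_natr => // k _ _; exact: integral_ge0.
by rewrite ge0_integral_bigcup//; exact: measurable_funTS.
Qed.

HB.instance Definition _ := isMeasure.Build _ _ _ with_density
  with_density0 with_density_ge0 with_density_sigma_additive.

(** Packages the indefinite integral as a measure, so that uniqueness theorems
    for measures apply to it. *)
Lemma measure_with_density : exists nu : {measure set T -> \bar R},
  forall D, nu D = \int[mu]_(x in D) f x.
Proof. by exists with_density. Qed.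

End measure_with_density.

Section joint_laws.
Context d (T : measurableType d) (R : realType) (P : probability T R).
Local Notation leb := (@lebesgue_measure R).
Implicit Types (X Y : T -> R) (f g : R -> \bar R) (E : set T).
Local Open Scope ereal_scope.

Definition has_density X f := forall B : set R, measurable B ->
  P (X @^-1` B) = \int[leb]_(x in B) f x.

(** Both sides are finite measures in [D] that agree on rectangles. This is
    what allows a function of [X] and [Y] to replace them in an independence
    statement. *)
Lemma joint_law_indep X Y E : measurable_fun [set: T] X ->
  measurable_fun [set: T] Y -> measurable E ->
  (forall B C, measurable B -> measurable C ->
    P (X @^-1` B `&` Y @^-1` C) = P (X @^-1` B) * P (Y @^-1` C)) ->
  (forall B C, measurable B -> measurable C ->
    P (X @^-1` B `&` Y @^-1` C `&` E) = P (X @^-1` B) * P (Y @^-1` C) * P E) ->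
  forall D : set (R * R), measurable D ->
    P ((fun w => (X w, Y w)) @^-1` D `&` E) =
    P ((fun w => (X w, Y w)) @^-1` D) * P E.
Proof.
move=> mX mY mE XY XYE D mD.
have mXY : measurable_fun [set: T] (fun w => (X w, Y w)).
  exact: measurable_fun_pair.
pose X' : {mfun T >-> R} := HB.pack X (isMeasurableFun.Build _ _ _ _ X mX).
pose Y' : {mfun T >-> R} := HB.pack Y (isMeasurableFun.Build _ _ _ _ Y mY).
pose XY' : {mfun T >-> (R * R)%type} :=
  HB.pack (fun w => (X w, Y w)) (isMeasurableFun.Build _ _ _ _ _ mXY).
have PE : P E \is a fin_num by exact: fin_num_measure.
have PE0 : (0 <= fine (P E))%R by rewrite fine_ge0.
pose k := NngNum PE0.
have kE : k%:num%:E = P E by rewrite /= fineK.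
pose m1 := mscale k (distribution P X').
pose m2 := distribution P Y'.
have [nu nuE] : exists nu : {measure set (R * R) -> \bar R},
    forall A, nu A = P ((fun w => (X w, Y w)) @^-1` A `&` E).
  by unshelve eexists (pushforward (mrestr P mE) (fun w => (X w, Y w))).
transitivity ((m1 \x m2)%E D).
  rewrite (@product_measure_unique _ _ _ _ _ m1 m2 nu) ?nuE// => B C mB mC.
  rewrite nuE XYE//.
  transitivity (k%:num%:E * P (X @^-1` B) * P (Y @^-1` C)) => //.
  by rewrite kE [LHS]muleC muleA.
rewrite (@product_measure_unique _ _ _ _ _ m1 m2
  (mscale k (distribution P XY'))) => //.
  transitivity (k%:num%:E * P ((fun w => (X w, Y w)) @^-1` D)) => //.
  by rewrite kE muleC.
move=> B C mB mC.
transitivity (k%:num%:E * P (X @^-1` B `&` Y @^-1` C)) => //.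
by rewrite XY// muleA.
Qed.

(** The law of [(X, Y)] and the measure of density [f x * g y] both agree with
    the product of the marginal laws on rectangles. *)
Lemma joint_density X Y f g : measurable_fun [set: T] X ->
  measurable_fun [set: T] Y -> measurable_fun [set: R] f ->
  measurable_fun [set: R] g -> (forall x, 0 <= f x) -> (forall x, 0 <= g x) ->
  (forall B C, measurable B -> measurable C ->
    P (X @^-1` B `&` Y @^-1` C) = P (X @^-1` B) * P (Y @^-1` C)) ->
  has_density X f -> has_density Y g ->
  forall D : set (R * R), measurable D ->
    P ((fun w => (X w, Y w)) @^-1` D) =
    \int[leb]_x \int[leb]_y (f x * g y * (\1_D (x, y))%:E).
Proof.
move=> mX mY mf mg f0 g0 XY Xf Yg D mD.
(* Lebesgue measure lives on [measurableTypeR R], whose display differs from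
   that of [R]; the variables are retyped to share it. *)
pose mR := measurableTypeR R.
have mX' : measurable_fun [set: T] (X : T -> mR) by exact: mX.
have mY' : measurable_fun [set: T] (Y : T -> mR) by exact: mY.
have mXY : measurable_fun [set: T] (fun w => (X w : mR, Y w : mR)).
  exact: measurable_fun_pair.
pose X' : {mfun T >-> mR} :=
  HB.pack (X : T -> mR) (isMeasurableFun.Build _ _ _ _ _ mX').
pose Y' : {mfun T >-> mR} :=
  HB.pack (Y : T -> mR) (isMeasurableFun.Build _ _ _ _ _ mY').
pose XY' : {mfun T >-> (mR * mR)%type} := HB.pack
  (fun w => (X w : mR, Y w : mR)) (isMeasurableFun.Build _ _ _ _ _ mXY).
pose h (p : measurableTypeR R * measurableTypeR R) : \bar R := f p.1 * g p.2.
have mh : measurable_fun setT h.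
  by apply: emeasurable_funM; [exact: (measurableT_comp mf measurable_fst)|
    exact: (measurableT_comp mg measurable_snd)].
have h0 p : 0 <= h p by rewrite mule_ge0.
have [nu nuE] := measure_with_density (leb \x leb) mh h0.
have nuI (A : set (measurableTypeR R * measurableTypeR R)) : measurable A ->
    nu A = \int[leb]_x \int[leb]_y (f x * g y * (\1_A (x, y))%:E).
  move=> mA; rewrite nuE integral_mkcond.
  rewrite fubini_tonelli1; last 2 first.
  - exact/(measurable_restrictT _ mA)/measurable_funTS.
  - by move=> p; exact: erestrict_ge0.
  apply: eq_integral => x _; apply: eq_integral => y _ /=.
  by rewrite patchE indicE; case: ifP => _; rewrite ?mule1 ?mule0.
rewrite -nuI//.
pose m1 := distribution P X'; pose m2 := distribution P Y'.
transitivity ((m1 \x m2)%E D).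
  by rewrite (@product_measure_unique _ _ _ _ _ m1 m2 (distribution P XY')).
apply: (@product_measure_unique _ _ _ _ _ m1 m2 nu) => // B C mB mC.
rewrite nuI; last exact: measurableX.
transitivity (\int[leb]_x ((f \_ B) x * P (Y @^-1` C))).
  apply: eq_integral => x _; rewrite Yg// [in RHS]integral_mkcond.
  rewrite -ge0_integralZl//; last 3 first.
  - exact/(measurable_restrictT _ mC)/measurable_funTS.
  - by move=> y _; exact: erestrict_ge0.
  - exact: erestrict_ge0.
  apply: eq_integral => y _; rewrite !patchE indicE in_setX.
  by case: (x \in B); case: (y \in C); rewrite ?(mule0, mule1, mul0e).
rewrite ge0_integralZr//.
- by rewrite -integral_mkcond -Xf.
- exact/(measurable_restrictT _ mB)/measurable_funTS.
- by move=> x _; exact: erestrict_ge0.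
Qed.

End joint_laws.

Section laws_of_sums.
Context d (T : measurableType d) (R : realType) (P : probability T R).
Local Notation leb := (@lebesgue_measure R).
Implicit Types (X Y : T -> R) (f g : R -> \bar R) (E : set T).
Local Open Scope ereal_scope.

Let integral_indic_mul (D : set R) (h : R -> \bar R) :
  \int[leb]_(x in D) h x = \int[leb]_x (h x * (\1_D x)%:E).
Proof.
rewrite integral_mkcond; apply: eq_integral => x _; rewrite patchE indicE.
by case: ifP; rewrite ?mule1 ?mule0.
Qed.

Lemma density_add X Y f g : measurable_fun [set: T] X ->
  measurable_fun [set: T] Y -> measurable_fun [set: R] f ->
  measurable_fun [set: R] g -> (forall x, 0 <= f x) -> (forall x, 0 <= g x) ->
  (forall B C, measurable B -> measurable C ->
    P (X @^-1` B `&` Y @^-1` C) = P (X @^-1` B) * P (Y @^-1` C)) ->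
  has_density P X f -> has_density P Y g ->
  has_density P (fun w => X w + Y w)%R (convolution f g).
Proof.
move=> mX mY mf mg f0 g0 XY Xf Yg B mB.
have madd : measurable_fun [set: R * R] (fun p : R * R => p.1 + p.2)%R.
  exact: measurable_funD.
pose D := (fun p : R * R => p.1 + p.2)%R @^-1` B.
have mD : measurable D by rewrite -[D]setTI; exact: madd.
transitivity (P ((fun w => (X w, Y w)) @^-1` D)) => //.
rewrite (joint_density mX mY mf mg f0 g0 XY Xf Yg mD) [RHS]integral_indic_mul.
have mB1 : measurable_fun [set: R] (fun x : R => (\1_B x)%:E : \bar R).
  by apply/measurable_EFinP; exact: measurable_indic.
have B0 x : 0 <= (\1_B x : R)%:E by rewrite lee_fin.
rewrite [RHS](integral_convolution mf mg mB1 f0 g0 B0).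
apply: eq_integral => x _.
rewrite -ge0_integralZl//; last 2 first.
- apply: emeasurable_funM => //; apply: (measurableT_comp mB1).
  exact: measurable_funD.
- by move=> y _; rewrite mule_ge0// lee_fin.
by apply: eq_integral => y _; rewrite muleA.
Qed.

(** Conditioning on [Y = y] leaves the distribution function of [X] at [k * y],
    which is the convolution of [f] with the indicator of the positive reals. *)
Lemma probability_le_scaled X Y f g k : measurable_fun [set: T] X ->
  measurable_fun [set: T] Y -> measurable_fun [set: R] f ->
  measurable_fun [set: R] g -> (forall x, 0 <= f x) -> (forall x, 0 <= g x) ->
  (forall B C, measurable B -> measurable C ->
    P (X @^-1` B `&` Y @^-1` C) = P (X @^-1` B) * P (Y @^-1` C)) ->
  has_density P X f -> has_density P Y g ->
  P [set w | (X w <= k * Y w)%R] =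
  \int[leb]_y (g y *
    convolution f (fun x => (if 0 < x then 1 else 0)%R%:E) (k * y)%R).
Proof.
move=> mX mY mf mg f0 g0 XY Xf Yg.
pose D := [set p : R * R | (p.1 <= k * p.2)%R].
have mD : measurable D.
  rewrite -[D]setTI.
  have : measurable_fun [set: R * R] (fun p : R * R => p.1 <= k * p.2)%R.
    by apply: measurable_fun_ler => //; exact: measurable_funM.
  by move=> /(_ measurableT [set true]); apply.
transitivity (P ((fun w => (X w, Y w)) @^-1` D)) => //.
rewrite (joint_density mX mY mf mg f0 g0 XY Xf Yg mD).
rewrite (fubini_tonelli (fun p : measurableTypeR R * measurableTypeR R =>
  f p.1 * g p.2 * (\1_D (p.1, p.2))%:E)); last 2 first.
- apply: emeasurable_funM; first apply: emeasurable_funM.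
  + exact: (measurableT_comp mf measurable_fst).
  + exact: (measurableT_comp mg measurable_snd).
  + apply/measurable_EFinP; rewrite (_ : (fun _ => _) = \1_D).
      exact: measurable_indic.
    by apply/funext => -[].
- by move=> p; rewrite !mule_ge0// lee_fin.
apply: eq_integral => y _ /=.
transitivity (\int[leb]_x
    (g y * (f x * (\1_(`]-oo, (k * y)%R]%classic) x)%:E))).
  by apply: eq_integral => x _; rewrite muleAC [RHS]muleC; congr (_ * _ * _).
rewrite ge0_integralZl//; last 2 first.
- apply: emeasurable_funM => //; apply/measurable_EFinP; exact: measurable_indic.
- by move=> x _; rewrite mule_ge0// lee_fin.
(* The convolution has the strict inequality; a point is a null set. *)
congr (_ * _); rewrite -integral_indic_mul -integral_itv_bndo_bndc; last first.
  exact: measurable_funTS.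
rewrite [LHS]integral_indic_mul; apply: eq_integral => x _; congr (_ * _%:E).
rewrite indicE subr_gt0; case: ifPn => xky.
  by rewrite mem_set//= in_itv.
by rewrite memNset//= in_itv/= (negbTE xky).
Qed.

Lemma density_scale X f c : (0 < c)%R -> measurable_fun [set: T] X ->
  measurable_fun [set: R] f -> (forall x, 0 <= f x) ->
  has_density P X f ->
  has_density P (fun w => c * X w)%R (fun x => c^-1%:E * f (c^-1 * x)%R).
Proof.
move=> c0 mX mf f0 Xf B mB.
have mc k : measurable_fun [set: R] (fun x : R => k * x)%R.
  exact: measurable_funM.
have mcB : measurable ((fun x : R => c * x)%R @^-1` B).
  by rewrite -[X in measurable X]setTI; exact: mc.
have ci0 : (0 < c^-1)%R by rewrite invr_gt0.
have mB1 : measurable_fun [set: R] (fun x : R => (\1_B x)%:E : \bar R).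
  by apply/measurable_EFinP; exact: measurable_indic.
rewrite -[LHS]/(P (X @^-1` ((fun x : R => c * x)%R @^-1` B))) Xf//.
rewrite [LHS]integral_indic_mul [RHS]integral_indic_mul.
have mh : measurable_fun [set: R] (fun x => f x * (\1_B (c * x)%R)%:E).
  by apply: emeasurable_funM => //; exact: (measurableT_comp mB1 (mc c)).
have h0 x : 0 <= f x * (\1_B (c * x)%R : R)%:E by rewrite mule_ge0// lee_fin.
rewrite -[LHS](ge0_integral_dilation ci0 mh h0).
rewrite -[LHS]ge0_integralZl//; last 2 first.
- exact: (measurableT_comp mh (mc c^-1%R)).
- by rewrite lee_fin ltW.
by apply: eq_integral => x _; rewrite mulrA divff ?mul1r ?muleA// gt_eqF.
Qed.

End laws_of_sums.

(** * Independence of weighted sums *)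

Section independent_sums.
Context d (T : measurableType d) (R : realType) (P : probability T R).
Context (I : finType) (X : I -> {RV P >-> R}).
Hypothesis indX : mutually_independent X.
Local Open Scope ereal_scope.

Let event (J : {set I}) (A : I -> set R) : set T :=
  \bigcap_(i in [set` J]) (X i @^-1` A i).

Let measurable_event (J : {set I}) A : (forall i, measurable (A i)) ->
  measurable (event J A).
Proof.
move=> mA; apply: fin_bigcap_measurable; first exact: finite_finset.
by move=> i _; rewrite -[X in measurable X]setTI; exact: measurable_funPT.
Qed.

Let eventU1 (J : {set I}) A i C : i \notin J ->
  X i @^-1` C `&` event J A =
  event (i |: J)%SET (fun j => if j == i then C else A j).
Proof.
move=> iJ; apply/seteqP; split => w.
  move=> [Xi XJ] j /=; rewrite in_setU1; case: eqP => [->//|_] /= jJ.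
  exact: XJ.
move=> XJ; split; first by have /= := XJ i; rewrite in_setU1 !eqxx => /(_ isT).
move=> j /= jJ; have /= := XJ j; rewrite in_setU1 jJ orbT => /(_ isT).
by case: eqP => // ji; rewrite ji (negbTE iJ) in jJ.
Qed.

Let measurable_ite (i : I) (C : set R) (A : I -> set R) : measurable C ->
  (forall j, measurable (A j)) ->
  forall j, measurable (if j == i then C else A j).
Proof. by move=> mC mA j; case: ifP. Qed.

Let event_indep (J : {set I}) A i C : i \notin J -> measurable C ->
  (forall j, measurable (A j)) ->
  P (event (i |: J)%SET (fun j => if j == i then C else A j)) =
  P (X i @^-1` C) * P (event J A).
Proof.
move=> iJ mC mA.
rewrite /event !indX//; last exact: measurable_ite.
rewrite big_setU1//= eqxx; congr (_ * _); apply: eq_bigr => j jJ.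
by case: eqP => // ji; rewrite ji (negbTE iJ) in jJ.
Qed.

Definition wsum (a : I -> R) (s : seq I) (w : T) : R :=
  (\sum_(i <- s) a i * X i w)%R.

Lemma measurable_wsum a s : measurable_fun [set: T] (wsum a s).
Proof.
by apply: measurable_sum => i; apply: measurable_funM.
Qed.

(** By induction on [s], quantifying over [J]: the induction hypothesis with
    [i |: J] makes the shorter sum, [X i] and the event jointly independent,
    and [joint_law_indep] merges the first two. *)
Lemma wsum_indep a s (J : {set I}) (B : set R) (A : I -> set R) :
  uniq s -> {in s, forall i, i \notin J} ->
  measurable B -> (forall i, measurable (A i)) ->
  P (wsum a s @^-1` B `&` \bigcap_(i in [set` J]) (X i @^-1` A i)) =
  P (wsum a s @^-1` B) * P (\bigcap_(i in [set` J]) (X i @^-1` A i)).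
Proof.
elim: s J B A => [|i s IH] J B A /=.
  move=> _ _ mB mA; rewrite /wsum; have [B0|B0] := pselect (B 0%R).
    rewrite (_ : _ @^-1` B = setT) ?setTI ?probability_setT ?mul1e//.
    by apply/seteqP; split => // w _ /=; rewrite big_nil.
  rewrite (_ : _ @^-1` B = set0) ?set0I ?measure0 ?mul0e//.
  by apply/seteqP; split => // w /=; rewrite big_nil.
move=> /andP[nis us] sJ mB mA.
have iJ : i \notin J by apply: sJ; rewrite mem_head.
have sJ' : {in s, forall j, j \notin J}.
  by move=> j js; apply: sJ; rewrite in_cons js orbT.
have mS := measurable_wsum a s.
have mXi : measurable_fun [set: T] (X i) by exact: measurable_funPT.
pose D := (fun p : R * R => p.1 + a i * p.2)%R @^-1` B.
have mD : measurable D.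
  have madd : measurable_fun [set: R * R] (fun p : R * R => p.1 + a i * p.2)%R.
    by apply: measurable_funD => //; exact: measurable_funM.
  by rewrite -[D]setTI; exact: madd.
have -> : wsum a (i :: s) @^-1` B = (fun w => (wsum a s w, X i w)) @^-1` D.
  by apply/seteqP; split => w /=; rewrite /D /wsum/= big_cons addrC.
have triple (K : {set I}) B' C : i \notin K -> {in s, forall j, j \notin K} ->
    measurable B' -> measurable C ->
    P (wsum a s @^-1` B' `&` X i @^-1` C `&` event K A) =
    P (wsum a s @^-1` B') * P (X i @^-1` C) * P (event K A).
  move=> iK sK mB' mC; rewrite -setIA eventU1// IH//; last 2 first.
  - move=> j js; rewrite in_setU1 negb_or sK// andbT.
    by apply: contraNneq nis => <-.
  - exact: measurable_ite.
  by rewrite -muleA; congr (_ * _); exact: event_indep.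
have event0 : event (@finset.set0 I) A = setT.
  by apply/seteqP; split => // w _ j /=; rewrite finset.in_set0.
apply: (joint_law_indep mS mXi (measurable_event J mA)) => // B' C mB' mC.
  have := triple (@finset.set0 I) B' C; rewrite event0 setIT probability_setT mule1.
  by apply => // [|j _]; rewrite finset.in_set0.
exact: triple.
Qed.

Lemma wsum_indep1 (a : I -> R) (s : seq I) (i : I) : uniq (i :: s) ->
  forall B D, measurable B -> measurable D ->
  P (wsum a s @^-1` B `&` (fun w => a i * X i w)%R @^-1` D) =
  P (wsum a s @^-1` B) * P ((fun w => a i * X i w)%R @^-1` D).
Proof.
move=> /= /andP[nis us] B D mB mD.
have mD' : measurable ((fun x => a i * x)%R @^-1` D).
  have m : measurable_fun [set: R] (fun x => a i * x)%R.
    exact: measurable_funM.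
  by rewrite -[X in measurable X]setTI; exact: m.
rewrite -[_ @^-1` D]/(X i @^-1` ((fun x => a i * x)%R @^-1` D)).
have := @wsum_indep a s [set i]%SET B (fun=> (fun x => a i * x)%R @^-1` D) us.
have -> : \bigcap_(j in [set` [set i]%SET])
    (X j @^-1` ((fun x => a i * x)%R @^-1` D)) =
    X i @^-1` ((fun x => a i * x)%R @^-1` D).
  apply/seteqP; split => w /=; first by apply; rewrite /= finset.in_set1.
  by move=> XD j /=; rewrite finset.in_set1 => /eqP ->.
apply => // j js; rewrite finset.in_set1.
by apply: contraNneq nis => <-.
Qed.

End independent_sums.

(** * Scaled chi-square variables *)

Section chi_square.
Context d (T : measurableType d) (R : realType) (P : probability T R).

Lemma measurable_chi2_pdf k : measurable_fun [set: R] (@chi2_pdf R k).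
Proof.
apply: measurable_fun_ifT => //; first exact: measurable_fun_ltr.
apply: measurable_funM => //; apply: measurable_funM; first exact: measurable_powR.
apply: (measurableT_comp (@measurable_expR R)).
by apply: measurable_funM => //; exact: measurable_funB.
Qed.

Lemma chi2_pdf_ge0 k (x : R) : (0 < k)%N -> 0 <= chi2_pdf k x.
Proof.
move=> k0; rewrite /chi2_pdf; case: ifP => // _.
have G0 : 0 < Gamma (k%:R / 2 : R) by rewrite Gamma_gt0// divr_gt0// ltr0n.
by rewrite divr_ge0 ?mulr_ge0 ?powR_ge0 ?expR_ge0// ltW.
Qed.

(** After scaling by [theta / 2] the exponential factor is [e ^ (- x / theta)],
    that is [e ^ (- x)] times [e ^ ((1 - theta^-1) x)]; the latter is expanded
    by [gamma_mixture_negbin], which needs [1 <= theta] for nonnegative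
    weights. *)
Lemma density_chi2_scaled (X : {RV P >-> R}) k theta : (0 < k)%N -> 1 <= theta ->
  chi2_distributed X k ->
  has_density P (fun w => theta / 2 * X w)
    (fun x => (theta `^ (- (k%:R / 2)))%:E *
      gamma_mixture (k%:R / 2) (negbin (k%:R / 2) (1 - theta^-1)) x)%E.
Proof.
move=> k0 t1 Xchi.
have b0 : 0 < k%:R / 2 :> R by rewrite divr_gt0// ltr0n.
have t0 : 0 < theta by exact: lt_le_trans t1.
have c0 : 0 < theta / 2 by rewrite divr_gt0.
have u0 : 0 <= 1 - theta^-1 by rewrite subr_ge0 invf_le1.
have XD : has_density P X (EFin \o @chi2_pdf R k) by [].
have -> : (fun x => (theta `^ (- (k%:R / 2)))%:E *
      gamma_mixture (k%:R / 2) (negbin (k%:R / 2) (1 - theta^-1)) x)%E =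
   (fun x => (theta / 2)^-1%:E * (chi2_pdf k ((theta / 2)^-1 * x))%:E)%E.
  apply/funext => x; rewrite gamma_mixture_negbin// -!EFinM; congr EFin.
  set b := k%:R / 2 in b0 *.
  have -> : chi2_pdf k ((theta / 2)^-1 * x) =
     pos_pow b ((theta / 2)^-1 * x) * expR (- ((theta / 2)^-1 * x) / 2) /
     (2 `^ b * Gamma b).
    by rewrite /chi2_pdf /pos_pow; case: ifP => // _; rewrite !mul0r.
  have -> : expR (- ((theta / 2)^-1 * x) / 2) =
      expR ((1 - theta^-1) * x) * expR (- x).
    by rewrite -expRD; congr expR; field; rewrite gt_eqF.
  have thetab : theta `^ (- b) = (theta / 2)^-1 `^ b / 2 `^ b.
    rewrite invfM invrK powRM ?invr_ge0 ?ltW// mulfK ?gt_eqF ?powR_gt0//.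
    by rewrite -powR_inv1 ?ltW// -powRrM mulN1r.
  rewrite thetab pos_powM ?invr_gt0//.
  rewrite -(@mulr_powRB1 _ (theta / 2)^-1 b) ?invr_ge0 ?ltW// (invfM (2 `^ b)).
  move: (Gamma b) (theta / 2)^-1 (expR _) (expR _) (2 `^ b) => g c e1 e2 p.
  by ring.
apply: (density_scale (f := EFin \o @chi2_pdf R k) c0) => //.
- by apply/measurable_EFinP; exact: measurable_chi2_pdf.
- by move=> x; rewrite lee_fin chi2_pdf_ge0.
Qed.

End chi_square.

(** * The law of a weighted sum *)

Section law_of_wsum.
Context d (T : measurableType d) (R : realType) (P : probability T R).
Local Open Scope ereal_scope.
Context (I : finType) (X : I -> {RV P >-> R}).
Hypothesis indX : mutually_independent X.
Variables (a b C : I -> R) (c : I -> nat -> R).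
Hypotheses (b0 : forall i, (0 < b i)%R) (C0 : forall i, (0 <= C i)%R).
Hypothesis c0 : forall i n, (0 <= c i n)%R.
Hypothesis dX : forall i, has_density P (fun w => a i * X i w)%R
  (fun x => (C i)%:E * gamma_mixture (b i) (c i) x).

Let mix_ge0 s (k : R) (e : nat -> R) : (0 < s)%R -> (0 <= k)%R ->
  (forall n, 0 <= e n)%R -> forall x, 0 <= k%:E * gamma_mixture s e x.
Proof. by move=> s0 k0 e0 x; rewrite mule_ge0// gamma_mixture_ge0. Qed.

Let measurable_mix s (k : R) (e : nat -> R) : (0 < s)%R ->
  (forall n, 0 <= e n)%R ->
  measurable_fun [set: R] (fun x => k%:E * gamma_mixture s e x).
Proof.
by move=> s0 e0; apply: emeasurable_funM => //; exact: measurable_gamma_mixture.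
Qed.

Lemma big_cauchy_ge0 (s : seq I) n :
  (0 <= (\big[@cauchy_prod R/@delta0 R]_(i <- s) c i) n)%R.
Proof.
elim/big_ind : _ n => [n|e f e0 f0|//]; last exact: cauchy_ge0.
exact: delta0_ge0.
Qed.

(** Adding one more independent term convolves the densities, which adds the
    shapes and Cauchy-multiplies the weights. The sum must be nonempty because
    there is no gamma density of shape [0]. *)
Lemma density_wsum (s : seq I) : s != [::] -> uniq s ->
  has_density P (wsum X a s) (fun x => (\prod_(i <- s) C i)%:E *
    gamma_mixture (\sum_(i <- s) b i)
      (\big[@cauchy_prod R/@delta0 R]_(i <- s) c i) x).
Proof.
elim: s => // i s IH _; have [->|s0] := eqVneq s [::].
  by rewrite !big_seq1 (_ : wsum X a [:: i] = (fun w => a i * X i w)%R)//;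
    apply/funext => w; rewrite /wsum big_seq1.
move=> uis; have us : uniq s by case/andP: uis.
have bs0 : (0 < \sum_(j <- s) b j)%R.
  case: s s0 {IH us uis} => // j s _; rewrite big_cons ltr_pwDl// sumr_ge0// => k _.
  exact: ltW.
have Cs0 : (0 <= \prod_(j <- s) C j)%R by exact: prodr_ge0.
have cs0 := big_cauchy_ge0 s.
have maX : measurable_fun [set: T] (fun w => a i * X i w)%R.
  exact: measurable_funM.
rewrite !big_cons.
rewrite (_ : (fun x => _) = convolution
  (fun x => (C i)%:E * gamma_mixture (b i) (c i) x)
  (fun x => (\prod_(j <- s) C j)%:E * gamma_mixture (\sum_(j <- s) b j)
     (\big[@cauchy_prod R/@delta0 R]_(j <- s) c j) x)); last first.
  by apply/funext => x; rewrite convolution_scaled_mixtures.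
rewrite (_ : wsum X a (i :: s) = (fun w => a i * X i w + wsum X a s w)%R); last first.
  by apply/funext => w; rewrite /wsum big_cons.
apply: density_add => //.
- exact: measurable_wsum.
- exact: measurable_mix.
- exact: measurable_mix.
- exact: mix_ge0.
- exact: mix_ge0.
- by move=> B D mB mD; rewrite setIC wsum_indep1// muleC.
- exact: IH.
Qed.

End law_of_wsum.

(** * The Lauricella function as a single series *)

Section lauricella_series.
Context {R : realType}.
Implicit Types p q s t : R.

(** Group the terms by total degree, the ratio of Pochhammer symbols depending
    on nothing else. The terms are nonnegative, so the sum of negative parts
    in the definition of the Lauricella function vanishes. *)
Lemma lauricellaFD_series n p s t (b u : 'I_n -> R) : 0 < p -> 0 < s -> 0 <= t ->
  (forall k, 0 < b k) -> (forall k, 0 <= u k) ->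
  lauricellaFD p b s (fun k => t * u k) =
  fine (\sum_(j <oo)
    ((\big[@cauchy_prod R/@delta0 R]_(k < n) negbin (b k) (u k)) j)%:E *
    (pochhammer p j / pochhammer s j * t ^+ j)%:E)%E.
Proof.
move=> p0 s0 t0 b0 u0.
have D0 k j : 0 <= negbin (b k) (u k) j by exact: negbin_ge0.
have G0 j : (0 <= (pochhammer p j / pochhammer s j * t ^+ j)%:E)%E.
  by rewrite lee_fin mulr_ge0 ?exprn_ge0// divr_ge0// ltW ?pochhammer_gt0.
rewrite (nneseries_big_cauchy D0 G0).
have termE i : (lauricellaFD_term p b s (fun k => t * u k) i)%:E =
    ((\prod_k negbin (b k) (u k) (i k))%:E *
     (pochhammer p (\sum_k i k) / pochhammer s (\sum_k i k) * t ^+ (\sum_k i k))%:E)%E.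
  rewrite -EFinM; congr EFin; rewrite /lauricellaFD_term [RHS]mulrCA; congr (_ * _).
  rewrite -prodrXr -big_split/=; apply: eq_bigr => k _.
  by rewrite /negbin exprMn; ring.
have term_ge0 i : (0 <= (lauricellaFD_term p b s (fun k => t * u k) i)%:E)%E.
  by rewrite termE mule_ge0// lee_fin prodr_ge0.
rewrite /lauricellaFD; congr fine.
rewrite [X in (_ - X)%E](_ : _ = 0%E) ?sube0; last first.
  by apply: esum1 => i _; rewrite funenegE; apply/max_idPr; rewrite leeNl oppe0.
by apply: eq_esum => i _; rewrite funeposE -termE; apply/max_idPl.
Qed.

End lauricella_series.

(** * The ratio of a gamma mixture to a gamma variable *)

Section ratio_of_gamma_mixtures.
Context d (T : measurableType d) (R : realType) (P : probability T R).
Local Notation leb := (@lebesgue_measure R).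
Local Open Scope ereal_scope.

(** The distribution function of [S] at [k * y] is its convolution with the
    indicator [gamma_mixture 1 (negbin 1 1)], a mixture again; each of its terms
    is integrated against the density of [V] by
    [integral_gamma_pdf_dilated]. *)
Lemma probability_gamma_mixture_le (S V : T -> R) (A b q k : R) (e : nat -> R) :
  measurable_fun [set: T] S -> measurable_fun [set: T] V ->
  (0 <= A)%R -> (0 < b)%R -> (0 < q)%R -> (0 < k)%R -> (forall n, 0 <= e n)%R ->
  (forall B D, measurable B -> measurable D ->
    P (S @^-1` B `&` V @^-1` D) = P (S @^-1` B) * P (V @^-1` D)) ->
  has_density P S (fun x => A%:E * gamma_mixture b e x) ->
  has_density P V (EFin \o gamma_pdf q) ->
  P [set w | (S w <= k * V w)%R] =
  A%:E * \sum_(n <oo) (cauchy_prod e (negbin 1 1) n)%:E *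
    (Gamma (q + (b + n%:R)) / (Gamma q * Gamma (b + n%:R + 1)) *
     (k `^ (b + n%:R) / (1 + k) `^ (q + (b + n%:R))))%:E.
Proof.
move=> mS mV A0 b0 q0 k0 e0 SV dS dV.
have n0 j : (0 <= negbin (1 : R) 1 j)%R by exact: negbin_ge0.
have c0 := cauchy_ge0 e0 n0.
have mgq : measurable_fun [set: R] (EFin \o gamma_pdf q).
  by apply/measurable_EFinP; exact: measurable_gamma_pdf.
have gq0 x : 0 <= (gamma_pdf q x)%:E by rewrite lee_fin gamma_pdf_ge0.
have gm0 x : 0 <= A%:E * gamma_mixture b e x.
  by rewrite mule_ge0// gamma_mixture_ge0.
have mgm : measurable_fun [set: R] (fun x => A%:E * gamma_mixture b e x).
  by apply: emeasurable_funM => //; exact: measurable_gamma_mixture.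
have b1 : (0 < b + 1)%R by rewrite addr_gt0.
rewrite (probability_le_scaled _ mS mV mgm mgq gm0 gq0 SV dS dV).
have mk : measurable_fun [set: R] (fun y : R => k * y)%R.
  exact: measurable_funM.
have mgk t : measurable_fun [set: R] (fun y => (gamma_pdf t (k * y)%R)%:E).
  apply/measurable_EFinP.
  exact: (measurableT_comp (measurable_gamma_pdf t) mk).
transitivity (\int[leb]_y (A%:E * \sum_(n <oo) (cauchy_prod e (negbin 1 1) n)%:E *
    ((gamma_pdf q y)%:E * (gamma_pdf (b + 1 + n%:R) (k * y))%:E))).
  apply: eq_integral => y _.
  rewrite (_ : (fun x : R => (if 0 < x then 1 else 0)%R%:E) =
     (fun x => 1%:E * gamma_mixture 1 (negbin 1 1) x)); last first.
    by apply/funext => x; rewrite gamma_mixture1 mul1e.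
  rewrite convolution_scaled_mixtures// mulr1 muleCA; congr (_ * _).
  rewrite /gamma_mixture -nneseriesZl; last first.
    by move=> n _; rewrite mule_ge0 ?lee_fin ?gamma_pdf_ge0// ltr_pwDl.
  by apply: eq_eseriesr => n _; rewrite muleCA.
have term0 n y : 0 <= (cauchy_prod e (negbin 1 1) n)%:E *
    ((gamma_pdf q y)%:E * (gamma_pdf (b + 1 + n%:R) (k * y))%:E).
  by rewrite !mule_ge0 ?lee_fin ?gamma_pdf_ge0// ltr_pwDl.
have mterm n : measurable_fun [set: R] (fun y =>
    (cauchy_prod e (negbin 1 1) n)%:E *
    ((gamma_pdf q y)%:E * (gamma_pdf (b + 1 + n%:R) (k * y))%:E)).
  apply: emeasurable_funM; first exact: measurable_cst.
  by apply: emeasurable_funM; [exact: mgq|exact: mgk].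
rewrite ge0_integralZl//; last 2 first.
- by apply: ge0_emeasurable_sum => [n y _ _|n _]; [exact: term0|exact: mterm].
- by move=> y _; apply: nneseries_ge0 => n _ _; exact: term0.
congr (_ * _); rewrite integral_nneseries//.
apply: eq_eseriesr => n _; rewrite ge0_integralZl//; last 3 first.
- by apply: emeasurable_funM; [exact: mgq|exact: mgk].
- by move=> y _; rewrite mule_ge0 ?lee_fin ?gamma_pdf_ge0// ltr_pwDl.
- by rewrite lee_fin.
rewrite (_ : b + 1 + n%:R = b + n%:R + 1)%R; last by rewrite addrAC.
by congr (_ * _); rewrite integral_gamma_pdf_dilated// ltr_pwDl.
Qed.

End ratio_of_gamma_mixtures.

Section constants.
Context {R : realType}.
Implicit Types (a b k q y : R).

(** Here [k / (1 + k)] plays the role of [t]: the part that depends on [n] is a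
    term of the single series of [lauricellaFD_series]. *)
Lemma ratio_cdf_coefE b q k n : 0 < b -> 0 < q -> 0 < k ->
  Gamma (q + (b + n%:R)) / (Gamma q * Gamma (b + n%:R + 1)) *
    (k `^ (b + n%:R) / (1 + k) `^ (q + (b + n%:R))) =
  Gamma (q + b) / (Gamma q * Gamma (b + 1)) * (k `^ b / (1 + k) `^ (q + b)) *
    (pochhammer (q + b) n / pochhammer (b + 1) n * (k / (1 + k)) ^+ n).
Proof.
move=> b0 q0 k0.
have qb0 : 0 < q + b by rewrite addr_gt0.
have b10 : 0 < b + 1 by rewrite addr_gt0.
have k10 : 0 < 1 + k by rewrite addr_gt0.
rewrite addrA [b + n%:R + 1]addrAC (GammaDn _ qb0) (GammaDn _ b10).
rewrite !gt0_powRD// !powR_mulrn ?ltW// expr_div_n.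
have := pochhammer_gt0 n b10; have := Gamma_gt0 q0; have := Gamma_gt0 b10.
have := powR_gt0 q k10; have := powR_gt0 b k10; have := exprn_gt0 n k10.
move: (Gamma q) (Gamma (q + b)) (Gamma (b + 1)) (pochhammer (q + b) n)
  (pochhammer (b + 1) n) ((1 + k) `^ q) ((1 + k) `^ b) ((1 + k) ^+ n)
  => g1 g2 g3 p1 p2 x1 x2 x3 x30 x20 x10 g30 g10 p20.
by field; rewrite !gt_eqF.
Qed.

Lemma ratio_cdf_constE a b q y : 0 < a -> 0 < b -> 0 < q -> 0 < y ->
  Gamma (q + b) / (Gamma q * Gamma (b + 1)) *
    ((y / a) `^ b / (1 + y / a) `^ (q + b)) =
  a `^ q * (Gamma (q + b) / (Gamma b * Gamma q)) *
    (y `^ b / (b * (a + y) `^ (q + b))).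
Proof.
move=> a0 b0 q0 y0.
have ay0 : 0 < a + y by rewrite addr_gt0.
have ya0 : 0 < y / a by rewrite divr_gt0.
have -> : a + y = a * (1 + y / a) by field; rewrite gt_eqF.
have y_ : y `^ b = a `^ b * (y / a) `^ b.
  by rewrite -powRM ?ltW// mulrC divfK// gt_eqF.
rewrite (@powRM _ a) ?ltW ?addr_gt0// y_ (GammaD1 b0) (gt0_powRD _ _ a0).
have := Gamma_gt0 b0; have := Gamma_gt0 q0.
have := powR_gt0 q a0; have := powR_gt0 b a0.
have : 0 < (1 + y / a) `^ (q + b) by rewrite powR_gt0// addr_gt0.
move: (Gamma q) (Gamma b) (Gamma (q + b)) ((1 + y / a) `^ (q + b))
  (a `^ q) (a `^ b) ((y / a) `^ b)
  => g1 g2 g3 x1 x2 x3 x4 x10 x30 x20 g10 g20.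
by field; rewrite !gt_eqF.
Qed.

End constants.

(** * Null events *)

Section null_events.
Context d (T : measurableType d) (R : realType) (P : probability T R).

(** Written with a power of the square because [x `^ (-1)] is the inverse of [x]
    only for nonnegative [x]. *)
Lemma measurable_fun_inv (X : T -> R) : measurable_fun [set: T] X ->
  measurable_fun [set: T] (fun w => (X w)^-1).
Proof.
move=> mX; rewrite (_ : (fun w => (X w)^-1) = (fun w => X w * (X w * X w) `^ (-1))).
  apply: measurable_funM => //.
  exact: (measurableT_comp (measurable_powR (-1)) (measurable_funM mX mX)).
apply/funext => w; rewrite powR_inv1 -?expr2 ?sqr_ge0//.
have [->|X0] := eqVneq (X w) 0; first by rewrite invr0 mul0r.
by rewrite expr2 invfM mulrA divff// mul1r.
Qed.

Lemma probability_eq_on (G A B : set T) : measurable G -> measurable A ->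
  measurable B -> P (~` G) = 0%E -> A `&` G = B `&` G -> P A = P B.
Proof.
move=> mG mA mB PG AB.
have PI C : measurable C -> P C = P (C `&` G).
  move=> mC; rewrite (measureDI P mC mG).
  rewrite [X in (X + _)%E](_ : _ = 0%E) ?add0e//.
  apply/eqP; rewrite eq_le measure_ge0 andbT -PG.
  apply: le_measure; rewrite ?inE//; first exact: measurableD.
  exact: measurableC.
by rewrite (PI A)// AB -PI.
Qed.

Lemma chi2_gt0_ae (V : {RV P >-> R}) k : chi2_distributed V k ->
  P (~` [set w | 0 < V w]) = 0%E.
Proof.
move=> Vchi.
have -> : ~` [set w | 0 < V w] = V @^-1` `]-oo, 0].
  by apply/seteqP; split => w /=; rewrite in_itv/= leNgt => /negP.
transitivity (chi2_prob k `]-oo, (0 : R)]); first by rewrite -Vchi.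
rewrite /chi2_prob; apply: integral0_eq => x /=; rewrite in_itv/= => x0.
by rewrite /chi2_pdf ltNge x0.
Qed.

End null_events.

(** * The distribution function of the ratio *)

(* MathComp-Analysis world. The number of chi-squares is r = n.+1; the paper's
   indices 1, ..., r are 0, ..., n here, so that ord_max is the index r.
   The family (X_1, ..., X_r, V) is indexed by option 'I_n.+1. *)
Theorem theorem3 (R : realType) (d : measure_display) (T : measurableType d)
    (P : probability T R) (n : nat) (hr : (2 <= n.+1)%N)
    (m : 'I_n.+1 -> nat) (nu : nat) (alpha : 'I_n.+1 -> R)
    (X : 'I_n.+1 -> {RV P >-> R}) (V : {RV P >-> R})
    (hm : forall i, (0 < m i)%N) (hnu : (0 < nu)%N)
    (halpha_decr : forall i j : 'I_n.+1, (i < j)%N -> alpha j < alpha i)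
    (halpha_pos : 0 < alpha ord_max)
    (hX : forall i, chi2_distributed (X i) (m i))
    (hV : chi2_distributed V nu)
    (hind : mutually_independent
       (fun o : option 'I_n.+1 => if o is Some i then X i else V))
    (y : R) (hy : 0 < y) :
  let M : R := (\sum_i m i)%N%:R in
  let N : R := nu%:R in
  let W : T -> R :=
    fun w => ((\sum_i alpha i * X i w) / M) / (V w / N) in
  let a : R := N * alpha ord_max / M in
  let t : R := y / (a + y) in
  let u : 'I_n.+1 -> R := fun i => 1 - alpha ord_max / alpha i in
  let A : R := \prod_i (alpha i / alpha ord_max) `^ (- (m i)%:R / 2) in
  let B0 : R :=
    a `^ (N / 2) * (Gamma ((N + M) / 2) / (Gamma (M / 2) * Gamma (N / 2))) in
  P [set w | W w <= y] =
  (A * B0 * (y `^ (M / 2) / (M / 2 * (a + y) `^ ((N + M) / 2))) *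
   lauricellaFD ((N + M) / 2)
     (fun i : 'I_n.+1 => if i == ord_max then 1 else (m i)%:R / 2)
     (M / 2 + 1)
     (fun i : 'I_n.+1 => if i == ord_max then t else t * u i))%:E.
Proof.
move=> M N W a t u A B0.
(* The denominator is treated as one more variable, of scale [theta = 1], so
   that every variable gets its density from the same lemma. *)
pose Z (o : option 'I_n.+1) := if o is Some i then X i else V.
pose theta (o : option 'I_n.+1) : R :=
  if o is Some i then alpha i / alpha ord_max else 1.
pose df (o : option 'I_n.+1) := if o is Some i then m i else nu.
pose b o : R := (df o)%:R / 2.
pose c o := negbin (b o) (1 - (theta o)^-1).
pose C o := theta o `^ (- b o).
have alpha_max i : alpha ord_max <= alpha i.
  have [->//|im] := eqVneq i ord_max; apply/ltW/halpha_decr.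
  by rewrite ltn_neqAle im -ltnS ltn_ord.
have alpha0 i : 0 < alpha i by exact: lt_le_trans (alpha_max i).
have theta1 o : 1 <= theta o.
  by case: o => //= i; rewrite ler_pdivlMr// mul1r.
have theta0 o : 0 < theta o by exact: lt_le_trans (theta1 o).
have df0 o : (0 < df o)%N by case: o.
have b0 o : 0 < b o by rewrite divr_gt0// ltr0n.
have C0 o : 0 <= C o by exact: powR_ge0.
have u0 o : 0 <= 1 - (theta o)^-1 by rewrite subr_ge0 invf_le1.
have uE k : u k = 1 - (theta (Some k))^-1 by rewrite /= invf_div.
have c0 o j : 0 <= c o j by exact: negbin_ge0.
have dZ o : has_density P (fun w => theta o / 2 * Z o w)
    (fun x => (C o)%:E * gamma_mixture (b o) (c o) x)%E.
  have hZ : chi2_distributed (Z o) (df o).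
    by case: o => [i|]; [exact: hX|exact: hV].
  exact: (density_chi2_scaled (df0 o) (theta1 o) hZ).
pose s := [seq Some i | i <- enum 'I_n.+1].
have us : uniq (None :: s).
  rewrite /= map_inj_uniq ?enum_uniq ?andbT; last by move=> i j [].
  by apply/negP => /mapP[].
have s0 : s != [::].
  by rewrite -size_eq0 size_map size_enum_ord.
pose a' o := theta o / 2.
pose S := wsum Z a' s.
pose V' w := a' None * V w.
have mS : measurable_fun [set: T] S by exact: measurable_wsum.
have mV' : measurable_fun [set: T] V'.
  by apply: measurable_funM => //; exact: measurable_funPT.
have bs : \sum_(o <- s) b o = M / 2.
  by rewrite big_map big_enum/= -mulr_suml /M natr_sum.
have dS := density_wsum hind b0 C0 c0 dZ s0 (proj2 (andP us)).
have SV := wsum_indep1 hind a' us.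
have dV : has_density P V' (EFin \o gamma_pdf (N / 2)).
  move=> B mB; rewrite dZ//; apply: eq_integral => x _.
  rewrite /C powR1 mul1e /c gamma_mixture_negbin// /=.
  by rewrite invr1 subrr mul0r expR0 mulr1.
have M0 : 0 < M by rewrite ltr0n big_ord_recl addn_gt0 hm.
have N0 : 0 < N by rewrite ltr0n.
have a0 : 0 < a by rewrite divr_gt0// mulr_gt0.
have k0 : 0 < y / a by rewrite divr_gt0.
have Cs0 : 0 <= \prod_(o <- s) C o by exact: prodr_ge0.
have bs0 : 0 < \sum_(o <- s) b o by rewrite bs divr_gt0.
have N20 : 0 < N / 2 by rewrite divr_gt0.
have main := probability_gamma_mixture_le mS mV' Cs0 bs0 N20 k0
  (big_cauchy_ge0 c0 s) SV dS dV.
have mX i : measurable_fun [set: T] (X i) by exact: measurable_funPT.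
have mV : measurable_fun [set: T] V by exact: measurable_funPT.
have mW : measurable_fun [set: T] W.
  apply: measurable_funM.
    apply: measurable_funM => //; apply: measurable_sum => i.
    exact: measurable_funM.
  by apply: measurable_fun_inv; exact: measurable_funM.
have mle (f g : T -> R) : measurable_fun [set: T] f ->
    measurable_fun [set: T] g -> measurable [set w | f w <= g w].
  move=> mf mg; have := measurable_fun_ler mf mg.
  by move=> /(_ measurableT [set true]); rewrite setTI; apply.
(* Clearing the denominator [V w / N] is only legitimate where it is positive. *)
have WS : P [set w | W w <= y] = P [set w | S w <= y / a * V' w].
  apply: (@probability_eq_on _ _ _ P [set w | 0 < V w]).
  - have := measurable_fun_ltr (measurable_cst (0 : R)) mV.
    by move=> /(_ measurableT [set true]); rewrite setTI; apply.
  - exact: mle.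
  - by apply: mle => //; exact: measurable_funM.
  - exact: chi2_gt0_ae hV.
  - have SE w : S w = (\sum_i alpha i * X i w) / M * (M / (2 * alpha ord_max)).
      rewrite /S /wsum big_map big_enum/= !mulr_suml; apply: eq_bigr => i _.
      by rewrite /a'/=; field; rewrite !gt_eqF.
    have VE w : y / a * V' w = y * (V w / N) * (M / (2 * alpha ord_max)).
      by rewrite /V' /a /a'/=; field; rewrite !gt_eqF.
    have r0 : 0 < M / (2 * alpha ord_max) by rewrite divr_gt0// mulr_gt0.
    apply/seteqP; split => w /= [Ww Vw]; split => //.
      by rewrite SE VE ler_pM2r// -ler_pdivrMr// divr_gt0.
    by move: Ww; rewrite SE VE ler_pM2r// -ler_pdivrMr// divr_gt0.
move: main; rewrite -WS bs.
(* The weights of index [ord_max] are the unit of the Cauchy product; those of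
   the indicator take their place, as the pair of parameters [(1, t)]. *)
have -> :
    cauchy_prod (\big[@cauchy_prod R/@delta0 R]_(o <- s) c o) (negbin 1 1) =
    \big[@cauchy_prod R/@delta0 R]_(k < n.+1)
      negbin (if k == ord_max then 1 else (m k)%:R / 2)
        (if k == ord_max then 1 else u k).
  rewrite big_map big_enum/= !big_ord_recr/= eqxx; congr cauchy_prod.
  have -> : c (Some ord_max) = @delta0 R.
    by rewrite /c /= divff ?gt_eqF// invr1 subrr negbin0.
  rewrite Monoid.mulm1; apply: eq_bigr => k _.
  have -> : (widen_ord (leqnSn n) k == ord_max) = false.
    by apply/negbTE; rewrite -val_eqE /= ltn_eqF.
  by rewrite uE.
have qb : (N + M) / 2 = N / 2 + M / 2 by rewrite mulrDl.
rewrite (_ : (fun i => if i == ord_max then t else t * u i) =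
   (fun i => t * (if i == ord_max then 1 else u i))); last first.
  by apply/funext => i; case: ifP; rewrite ?mulr1.
have t0 : 0 <= t by rewrite divr_ge0 ?addr_ge0 ?ltW.
rewrite lauricellaFD_series//; last 4 first.
- by rewrite qb addr_gt0// divr_gt0.
- by rewrite addr_gt0// divr_gt0.
- by move=> k; case: ifP => // _; rewrite divr_gt0// ltr0n.
- by move=> k; case: ifP => // _; rewrite uE; exact: u0.
set e := \big[_/_]_(k < _) _.
pose G j : \bar R :=
  (pochhammer ((N + M) / 2) j / pochhammer (M / 2 + 1) j * t ^+ j)%:E.
pose K := a `^ (N / 2) *
  (Gamma ((N + M) / 2) / (Gamma (M / 2) * Gamma (N / 2))) *
  (y `^ (M / 2) / (M / 2 * (a + y) `^ ((N + M) / 2))).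
have NM0 : 0 < (N + M) / 2 by rewrite qb addr_gt0// divr_gt0.
have M20 : 0 < M / 2 by rewrite divr_gt0.
have K0 : 0 < K.
  by rewrite /K !(mulr_gt0, divr_gt0, invr_gt0, powR_gt0, Gamma_gt0)//
    addr_gt0.
have e0 j : 0 <= e j.
  rewrite /e; elim/big_ind : _ j => [j|f g f0 g0|k _ j].
  - exact: delta0_ge0.
  - exact: cauchy_ge0.
  - apply: negbin_ge0; case: ifP => // _; last by rewrite uE; exact: u0.
    by rewrite divr_gt0// ltr0n.
have G0 j : (0 <= G j)%E.
  by rewrite lee_fin mulr_ge0 ?exprn_ge0// divr_ge0// ltW ?pochhammer_gt0// addr_gt0.
have tE : t = y / a / (1 + y / a).
  by rewrite /t; field; rewrite !gt_eqF// addr_gt0.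
rewrite [X in (_ * X)%E](_ : _ =
    (K%:E * \sum_(j <oo) (e j)%:E * G j)%E); last first.
  rewrite -nneseriesZl; last by move=> j _; rewrite mule_ge0// lee_fin.
  apply: eq_eseriesr => j _; rewrite muleCA; congr (_ * _)%E.
  rewrite -EFinM; congr EFin.
  by rewrite ratio_cdf_coefE// ratio_cdf_constE// -qb -tE.
have -> : \prod_(o <- s) C o = A.
  by rewrite big_map big_enum/=; apply: eq_bigr => i _; rewrite /C /= mulNr.
have A0 : 0 < A by apply: prodr_gt0 => i _; rewrite powR_gt0// divr_gt0.
rewrite muleA -EFinM.
have AK0 : 0 < A * K by rewrite mulr_gt0.
have F0 : (0 <= \sum_(j <oo) (e j)%:E * G j)%E.
  by apply: nneseries_ge0 => j _ _; rewrite mule_ge0// lee_fin.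
move=> main.
(* The series converges because a probability is finite. *)
have Ffin : (\sum_(j <oo) (e j)%:E * G j)%E \is a fin_num.
  rewrite ge0_fin_numE// ltey; apply/eqP => Fy.
  have : P [set w | W w <= y] \is a fin_num.
    by apply: fin_num_measure; exact: mle.
  by rewrite main Fy gt0_muley.
rewrite main -(fineK Ffin) -EFinM; congr EFin.
by rewrite /K /B0 !mulrA.
Qed.
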